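(* Let $F$ be a field of characteristic zero and let $\mathfrak g$ be a Borcherds Lie algebra over $F$ of finite rank $l$, with Cartan subalgebra $\mathfrak h$ and Chevalley generators $e_1,\dots,e_l,f_1,\dots,f_l$. Let $\mathfrak g'=[\mathfrak g,\mathfrak g]$, $\mathfrak h'=\mathfrak h\cap\mathfrak g'$, and let $\mathfrak h''$ be a vector space complement of $\mathfrak h'$ in $\mathfrak h$. Let $\mathfrak g_+$ (resp. $\mathfrak g_-$) be the subalgebra of $\mathfrak g$ generated by $e_1,\dots,e_l$ (resp. $f_1,\dots,f_l$). Then $$U(\mathfrak g)=U(\mathfrak g_+)\,U(\mathfrak g_-)\,U(\mathfrak h'')\,U(\mathfrak g_+)\quad\text{and}\quad U(\mathfrak g)=U(\mathfrak g_-)\,U(\mathfrak g_+)\,U(\mathfrak h'')\,U(\mathfrak g_-).$$ Hence, if $\mathfrak g$ is perfect (that is, $\mathfrak g=[\mathfrak g,\mathfrak g]$), then $\mathfrak g$ has a plus-minus pair. In particular, every perfect Kac-Moody Lie algebra of finite rank and, more generally, every perfect Borcherds Lie algebra of finite rank has a regular plus-minus pair.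
   Context: For a Lie algebra $\mathfrak a$ over $F$, $U(\mathfrak a)$ denotes its universal enveloping algebra; for a subalgebra $\mathfrak b\subseteq\mathfrak a$, $U(\mathfrak b)$ is regarded as a subalgebra of $U(\mathfrak a)$. For subspaces $A,B$ of $U(\mathfrak a)$, $AB$ denotes the linear span of all products $ab$ with $a\in A$, $b\in B$. A Lie algebra $L$ has a plus-minus pair $(P,M)$ if $P,M$ are subalgebras of $L$ with $P+M\neq L$ (vector space sum) and $U(L)=U(P)U(M)U(P)$. A plus-minus pair $(P,M)$ of $L$ is regular if $P\cap M=(0)$ and there is an automorphism $\sigma$ of $L$ of order two with $\sigma(P)=M$. Borcherds Lie algebras (generalized Kac-Moody algebras) of rank $l\ge 1$: let $A=(a_{ij})$ be a real $l\times l$ matrix, with entries in a subfield of $\mathbb R$ embedded in $F$, such that (i) $a_{ii}=2$ or $a_{ii}\le 0$; (ii) $a_{ij}\le 0$ for $i\ne j$, and $a_{ij}\in\mathbb Z$ if $a_{ii}=2$; (iii) $a_{ij}=0$ implies $a_{ji}=0$. Let $\mathfrak h$ be a finite dimensional $F$-vector space with linearly independent elements $h_1,\dots,h_l\in\mathfrak h$ and nonzero functionals $\alpha_1,\dots,\alpha_l\in\mathfrak h^*$ with $\alpha_j(h_i)=a_{ij}$. Let $\tilde{\mathfrak g}$ be the Lie algebra generated by $\mathfrak h$, $e_i,f_i$ ($1\le i\le l$) with relations $[h,\bar h]=0$, $[h,e_i]=\alpha_i(h)e_i$, $[h,f_i]=-\alpha_i(h)f_i$, $[e_i,f_j]=\delta_{ij}h_i$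 for $h,\bar h\in\mathfrak h$; it is graded by the free abelian group on $\varepsilon_1,\dots,\varepsilon_l$ via $\deg e_i=\varepsilon_i$, $\deg f_i=-\varepsilon_i$, $\deg\mathfrak h=0$. Then $\mathfrak g$ is the quotient of $\tilde{\mathfrak g}$ by its largest graded ideal meeting $\mathfrak h$ trivially. One has $\mathfrak g=\mathfrak g_-\oplus\mathfrak h\oplus\mathfrak g_+$ and $\mathfrak g=\mathfrak h''\oplus\mathfrak g'$. Kac-Moody Lie algebras are the case where all $a_{ii}=2$ and all entries are integers. *)

(* Defs.v *)
From HB Require Import structures.
From mathcomp Require Import all_boot all_algebra.
From mathcomp Require Import boolp classical_sets reals.

Set Implicit Arguments.
Unset Strict Implicit.
Unset Printing Implicit Defensive.

Import GRing.Theory.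

Local Open Scope ring_scope.
Local Open Scope classical_set_scope.
Local Open Scope quotient_scope.

Reserved Notation "[lie x , y ]" (at level 0, format "[lie  x ,  y ]").

HB.mixin Record Lmodule_isLieAlgebra (F : fieldType) L of GRing.Lmodule F L := {
  lie_bracket : L -> L -> L;
  lie_linearl : forall a x y z,
    lie_bracket (a *: x + y) z = a *: lie_bracket x z + lie_bracket y z;
  lie_linearr : forall a x y z,
    lie_bracket z (a *: x + y) = a *: lie_bracket z x + lie_bracket z y;
  lie_xx : forall x, lie_bracket x x = 0;
  lie_jacobi : forall x y z,
    lie_bracket x (lie_bracket y z) + lie_bracket y (lie_bracket z x)
      + lie_bracket z (lie_bracket x y) = 0
}.

#[short(type="lieAlgType")]
HB.structure Definition LieAlgebra (F : fieldType) :=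
  {L of GRing.Lmodule F L & Lmodule_isLieAlgebra F L}.

Notation "[lie x , y ]" := (lie_bracket x y) : ring_scope.

Section LinearSets.
Variables (F : fieldType) (V : lmodType F).

Definition subspace (B : set V) : Prop :=
  B 0 /\ forall a x y, B x -> B y -> B (a *: x + y).

Definition lspan (S : set V) : set V := smallest subspace S.

(* W = B (+) C *)
Definition complement (B C W : set V) : Prop :=
  [/\ subspace B, B `&` C = [set 0] & [set x + y | x in B & y in C] = W].

End LinearSets.

Section LieTheory.
Variables (F : fieldType) (L : lieAlgType F).

Definition lie_morphism (L' : lieAlgType F) (f : L -> L') : Prop :=
  forall x y, f [lie x, y] = [lie f x, f y].

Definition lie_subalgebra (B : set L) : Prop :=
  subspace B /\ forall x y, B x -> B y -> B [lie x, y].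

Definition lie_ideal (I : set L) : Prop :=
  subspace I /\ forall x y, I y -> I [lie x, y].

Definition derived : set L :=
  lspan [set [lie x, y] | x in [set: L] & y in [set: L]].

Definition perfect : Prop := derived = [set: L].

Record lieSubalg := LieSubalg {
  subalg_set :> set L;
  subalgP : lie_subalgebra subalg_set
}.

Lemma gen_subalg_subproof (S : set L) :
  lie_subalgebra (smallest lie_subalgebra S).
Proof.
split=> [|x y Bx By B [sB lB]]; last by apply: sB.2; [apply: Bx|apply: By].
split=> [B [[[]]]//|a x y Bx By B [[sB lB] SB]].
by apply: sB.2; [apply: Bx|apply: By].
Qed.

Definition gen_subalg (S : set L) : lieSubalg :=
  LieSubalg (gen_subalg_subproof S).

End LieTheory.

Arguments derived {F} L.
Arguments perfect {F} L.
Arguments lieSubalg {F} L.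

Section SubLie.
Variables (F : fieldType) (L : lieAlgType F) (B : lieSubalg L).

Definition subalg_pred : {pred L} := fun x => `[< subalg_set B x >].

Lemma subalg_predP x : reflect (subalg_set B x) (x \in subalg_pred).
Proof. exact: asboolP. Qed.

Lemma subalg_submod_closed : submod_closed subalg_pred.
Proof.
split; first by apply/asboolP; case: (subalgP B) => [[]].
move=> a x y /asboolP Bx /asboolP By; apply/asboolP.
by case: (subalgP B) => [[_ H] _]; apply: H.
Qed.

HB.instance Definition _ :=
  GRing.isSubmodClosed.Build F L subalg_pred subalg_submod_closed.

Record lie_sub := LieSub { lie_sub_val :> L; _ : lie_sub_val \in subalg_pred }.

HB.instance Definition _ := [isSub for lie_sub_val].
HB.instance Definition _ := [Choice of lie_sub by <:].
HB.instance Definition _ := [SubChoice_isSubLmodule of lie_sub by <:].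

Lemma lie_sub_bracket_subproof (x y : lie_sub) :
  [lie val x, val y] \in subalg_pred.
Proof.
case: (subalgP B) => _ H.
by apply/subalg_predP/H; apply/subalg_predP; apply: valP.
Qed.

Definition lie_sub_bracket (x y : lie_sub) : lie_sub :=
  LieSub (lie_sub_bracket_subproof x y).

Fact lie_sub_linearl a x y z :
  lie_sub_bracket (a *: x + y) z
    = a *: lie_sub_bracket x z + lie_sub_bracket y z.
Proof. by apply: val_inj; exact: lie_linearl. Qed.

Fact lie_sub_linearr a x y z :
  lie_sub_bracket z (a *: x + y)
    = a *: lie_sub_bracket z x + lie_sub_bracket z y.
Proof. by apply: val_inj; exact: lie_linearr. Qed.

Fact lie_sub_xx x : lie_sub_bracket x x = 0.
Proof. by apply: val_inj; exact: lie_xx. Qed.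

Fact lie_sub_jacobi x y z :
  lie_sub_bracket x (lie_sub_bracket y z)
    + lie_sub_bracket y (lie_sub_bracket z x)
    + lie_sub_bracket z (lie_sub_bracket x y) = 0.
Proof. by apply: val_inj; exact: lie_jacobi. Qed.

HB.instance Definition _ := Lmodule_isLieAlgebra.Build F lie_sub
  lie_sub_linearl lie_sub_linearr lie_sub_xx lie_sub_jacobi.

End SubLie.

(* U(L) is presented as a unital associative F-algebra: formal expressions    *)
(* modulo the least congruence imposing the algebra axioms, the linearity of  *)
(* x |-> iota x, and iota [x, y] = iota x * iota y - iota y * iota x.         *)
Section Enveloping.
Variables (F : fieldType) (L : lieAlgType F).

Inductive uterm : Type :=
| UGen of L
| UZero
| UOne
| UAdd of uterm & uterm
| UOpp of uterm
| UScale of F & uterm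
| UMul of uterm & uterm.

Inductive ueq : uterm -> uterm -> Prop :=
| ueq_refl t : ueq t t
| ueq_sym s t : ueq s t -> ueq t s
| ueq_trans s t u : ueq s t -> ueq t u -> ueq s u
| ueq_add s s' t t' : ueq s s' -> ueq t t' -> ueq (UAdd s t) (UAdd s' t')
| ueq_opp s s' : ueq s s' -> ueq (UOpp s) (UOpp s')
| ueq_scale a s s' : ueq s s' -> ueq (UScale a s) (UScale a s')
| ueq_mul s s' t t' : ueq s s' -> ueq t t' -> ueq (UMul s t) (UMul s' t')
| ueq_addA s t u : ueq (UAdd s (UAdd t u)) (UAdd (UAdd s t) u)
| ueq_addC s t : ueq (UAdd s t) (UAdd t s)
| ueq_add0 s : ueq (UAdd UZero s) s
| ueq_addN s : ueq (UAdd (UOpp s) s) UZero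
| ueq_scaleA a b s : ueq (UScale a (UScale b s)) (UScale (a * b) s)
| ueq_scale1 s : ueq (UScale 1 s) s
| ueq_scaleDr a s t : ueq (UScale a (UAdd s t)) (UAdd (UScale a s) (UScale a t))
| ueq_scaleDl a b s : ueq (UScale (a + b) s) (UAdd (UScale a s) (UScale b s))
| ueq_mulA s t u : ueq (UMul s (UMul t u)) (UMul (UMul s t) u)
| ueq_mul1l s : ueq (UMul UOne s) s
| ueq_mul1r s : ueq (UMul s UOne) s
| ueq_mulDl s t u : ueq (UMul (UAdd s t) u) (UAdd (UMul s u) (UMul t u))
| ueq_mulDr s t u : ueq (UMul s (UAdd t u)) (UAdd (UMul s t) (UMul s u))
| ueq_scaleAl a s t : ueq (UScale a (UMul s t)) (UMul (UScale a s) t)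
| ueq_scaleAr a s t : ueq (UScale a (UMul s t)) (UMul s (UScale a t))
| ueq_gen a x y : ueq (UGen (a *: x + y)) (UAdd (UScale a (UGen x)) (UGen y))
| ueq_lie x y : ueq (UGen [lie x, y])
    (UAdd (UMul (UGen x) (UGen y)) (UOpp (UMul (UGen y) (UGen x)))).

HB.instance Definition _ := gen_eqMixin uterm.
HB.instance Definition _ := gen_choiceMixin uterm.

Definition ueqb : rel uterm := fun s t => `[< ueq s t >].

Fact ueqb_equiv : equiv_class_of ueqb.
Proof.
split=> [t|s t|t s u].
- by apply/asboolP/ueq_refl.
- by apply/asboolP/asboolP => /ueq_sym.
- by move=> /asboolP st /asboolP tu; apply/asboolP/(ueq_trans st tu).
Qed.

Canonical ueqb_equiv_rel := EquivRelPack ueqb_equiv.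

Definition env := {eq_quot ueqb}.
HB.instance Definition _ := Choice.on env.
HB.instance Definition _ := Quotient.on env.

Lemma env_piP s t : ueq s t <-> \pi_env s = \pi_env t.
Proof.
split=> [st|/eqmodP/asboolP//].
by apply/eqmodP/asboolP.
Qed.

Lemma env_repr t : ueq (repr (\pi_env t)) t.
Proof. by apply/env_piP; rewrite reprK. Qed.

Lemma env_ind (P : env -> Prop) : (forall t, P (\pi_env t)) -> forall u, P u.
Proof. by move=> HP u; rewrite -[u]reprK. Qed.

Definition env_add (u v : env) : env := \pi_env (UAdd (repr u) (repr v)).
Definition env_opp (u : env) : env := \pi_env (UOpp (repr u)).
Definition env_mul (u v : env) : env := \pi_env (UMul (repr u) (repr v)).
Definition env_scale a (u : env) : env := \pi_env (UScale a (repr u)).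

Lemma env_addE s t : env_add (\pi_env s) (\pi_env t) = \pi_env (UAdd s t).
Proof. by apply/env_piP/ueq_add; apply: env_repr. Qed.
Lemma env_oppE s : env_opp (\pi_env s) = \pi_env (UOpp s).
Proof. by apply/env_piP/ueq_opp; apply: env_repr. Qed.
Lemma env_mulE s t : env_mul (\pi_env s) (\pi_env t) = \pi_env (UMul s t).
Proof. by apply/env_piP/ueq_mul; apply: env_repr. Qed.
Lemma env_scaleE a s : env_scale a (\pi_env s) = \pi_env (UScale a s).
Proof. by apply/env_piP/ueq_scale; apply: env_repr. Qed.

Definition env_opE := (env_addE, env_oppE, env_mulE, env_scaleE).

Section Eval.
Variables (A : algType F) (f : L -> A).

Fixpoint ueval (t : uterm) : A :=
  match t with
  | UGen x => f x
  | UZero => 0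
  | UOne => 1
  | UAdd s t => ueval s + ueval t
  | UOpp s => - ueval s
  | UScale a s => a *: ueval s
  | UMul s t => ueval s * ueval t
  end.

Hypothesis f_linear : linear f.
Hypothesis f_lie : forall x y, f [lie x, y] = f x * f y - f y * f x.

Lemma ueq_ueval s t : ueq s t -> ueval s = ueval t.
Proof.
elim=> {s t} //=; do ?by move=> *; congruence.
- by move=> *; rewrite addrA.
- by move=> *; rewrite addrC.
- by move=> *; rewrite add0r.
- by move=> *; rewrite addNr.
- by move=> *; rewrite scalerA.
- by move=> *; rewrite scale1r.
- by move=> *; rewrite scalerDr.
- by move=> *; rewrite scalerDl.
- by move=> *; rewrite mulrA.
- by move=> *; rewrite mul1r.
- by move=> *; rewrite mulr1.
- by move=> *; rewrite mulrDl.
- by move=> *; rewrite mulrDr.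
- by move=> *; rewrite scalerAl.
- by move=> *; rewrite scalerAr.
Qed.

End Eval.

Fact env_addA : associative env_add.
Proof.
elim/env_ind=> s; elim/env_ind=> t; elim/env_ind=> u; rewrite !env_opE.
exact/env_piP/ueq_addA.
Qed.
Fact env_addC : commutative env_add.
Proof.
elim/env_ind=> s; elim/env_ind=> t; rewrite !env_opE; exact/env_piP/ueq_addC.
Qed.
Fact env_add0 : left_id (\pi_env UZero) env_add.
Proof. elim/env_ind=> s; rewrite !env_opE; exact/env_piP/ueq_add0. Qed.
Fact env_addN : left_inverse (\pi_env UZero) env_opp env_add.
Proof. elim/env_ind=> s; rewrite !env_opE; exact/env_piP/ueq_addN. Qed.

HB.instance Definition _ :=
  GRing.isZmodule.Build env env_addA env_addC env_add0 env_addN.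

Fact env_mulA : associative env_mul.
Proof.
elim/env_ind=> s; elim/env_ind=> t; elim/env_ind=> u; rewrite !env_opE.
exact/env_piP/ueq_mulA.
Qed.
Fact env_mul1l : left_id (\pi_env UOne) env_mul.
Proof. elim/env_ind=> s; rewrite !env_opE; exact/env_piP/ueq_mul1l. Qed.
Fact env_mul1r : right_id (\pi_env UOne) env_mul.
Proof. elim/env_ind=> s; rewrite !env_opE; exact/env_piP/ueq_mul1r. Qed.
Fact env_mulDl : left_distributive env_mul env_add.
Proof.
elim/env_ind=> s; elim/env_ind=> t; elim/env_ind=> u; rewrite !env_opE.
exact/env_piP/ueq_mulDl.
Qed.
Fact env_mulDr : right_distributive env_mul env_add.
Proof.
elim/env_ind=> s; elim/env_ind=> t; elim/env_ind=> u; rewrite !env_opE.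
exact/env_piP/ueq_mulDr.
Qed.
(* The zero map L -> F induces the augmentation, which separates 1 from 0. *)
Fact env_1_neq0 : \pi_env UOne != \pi_env UZero.
Proof.
have lin0 : linear ((fun=> 0) : L -> F^o).
  by move=> a x y; rewrite scaler0 addr0.
have lie0 x y : ((fun=> 0) : L -> F^o) [lie x, y] = 0 * 0 - 0 * 0.
  by rewrite mulr0 subr0.
apply/eqP => /env_piP /(ueq_ueval lin0 lie0) /= /eqP.
exact/negP/oner_neq0.
Qed.

HB.instance Definition _ := GRing.Zmodule_isNzRing.Build env
  env_mulA env_mul1l env_mul1r env_mulDl env_mulDr env_1_neq0.

Fact env_scaleA a b (u : env) :
  env_scale a (env_scale b u) = env_scale (a * b) u.
Proof. elim/env_ind: u => s; rewrite !env_opE; exact/env_piP/ueq_scaleA. Qed.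
Fact env_scale1 : left_id 1 env_scale.
Proof. elim/env_ind=> s; rewrite !env_opE; exact/env_piP/ueq_scale1. Qed.
Fact env_scaleDr : right_distributive env_scale +%R.
Proof.
move=> a; elim/env_ind=> s; elim/env_ind=> t.
rewrite -[LHS]/(env_scale a (env_add _ _)) -[RHS]/(env_add _ _) !env_opE.
exact/env_piP/ueq_scaleDr.
Qed.
Fact env_scaleDl u : {morph env_scale^~ u : a b / a + b}.
Proof.
move=> a b /=; elim/env_ind: u => s.
rewrite -[RHS]/(env_add _ _) !env_opE; exact/env_piP/ueq_scaleDl.
Qed.

HB.instance Definition _ := GRing.Zmodule_isLmodule.Build F env
  env_scaleA env_scale1 env_scaleDr env_scaleDl.

Fact env_scaleAl a (u v : env) : a *: (u * v) = a *: u * v.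
Proof.
elim/env_ind: u => s; elim/env_ind: v => t.
rewrite -[LHS]/(env_scale a (env_mul _ _)) -[RHS]/(env_mul (env_scale _ _) _).
rewrite !env_opE; exact/env_piP/ueq_scaleAl.
Qed.
HB.instance Definition _ := GRing.Lmodule_isLalgebra.Build F env env_scaleAl.

Fact env_scaleAr a (u v : env) : a *: (u * v) = u * (a *: v).
Proof.
elim/env_ind: u => s; elim/env_ind: v => t.
rewrite -[LHS]/(env_scale a (env_mul _ _)) -[RHS]/(env_mul _ (env_scale _ _)).
rewrite !env_opE; exact/env_piP/ueq_scaleAr.
Qed.
HB.instance Definition _ := GRing.Lalgebra_isAlgebra.Build F env env_scaleAr.

Definition env_iota (x : L) : env := \pi_env (UGen x).

(* The algebra morphism extending f, when f is linear and maps brackets to    *)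
(* commutators; no meaning otherwise.                                         *)
Definition env_ext (A : algType F) (f : L -> A) (u : env) : A :=
  ueval f (repr u).

Lemma env_iota_linear : linear env_iota.
Proof.
move=> a x y; rewrite -[RHS]/(env_add (env_scale _ _) _) /env_iota !env_opE.
exact/env_piP/ueq_gen.
Qed.

Lemma env_iota_lie x y :
  env_iota [lie x, y] = env_iota x * env_iota y - env_iota y * env_iota x.
Proof.
rewrite -[RHS]/(env_add (env_mul _ _) (env_opp (env_mul _ _))) /env_iota.
rewrite !env_opE.
exact/env_piP/ueq_lie.
Qed.

Section UniversalProperty.
Variables (A : algType F) (f : L -> A).
Hypothesis f_linear : linear f.
Hypothesis f_lie : forall x y, f [lie x, y] = f x * f y - f y * f x.

Lemma env_ext_pi t : env_ext f (\pi_env t) = ueval f t.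
Proof. exact/ueq_ueval/env_repr. Qed.

Lemma env_ext_iota x : env_ext f (env_iota x) = f x.
Proof. exact: env_ext_pi. Qed.

Lemma env_ext_linear : linear (env_ext f).
Proof.
move=> a; elim/env_ind=> s; elim/env_ind=> t.
rewrite -[_ + _ in LHS]/(env_add (env_scale _ _) _).
by rewrite !env_opE !env_ext_pi.
Qed.

Lemma env_ext_monoid_morphism : monoid_morphism (env_ext f).
Proof.
split; first exact: env_ext_pi.
elim/env_ind=> s; elim/env_ind=> t.
by rewrite -[_ * _ in LHS]/(env_mul _ _) !env_opE !env_ext_pi.
Qed.

Lemma env_ext_unique (phi : {lrmorphism env -> A}) :
  (forall x, phi (env_iota x) = f x) -> phi =1 env_ext f.
Proof.
move=> phiE; elim/env_ind=> t; rewrite env_ext_pi.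
elim: t => [x||| s IHs t IHt | s IHs | a s IHs | s IHs t IHt] /=.
- exact: phiE.
- exact: raddf0.
- exact: rmorph1.
- by rewrite -env_addE -IHs -IHt -rmorphD.
- by rewrite -env_oppE -IHs -rmorphN.
- by rewrite -env_scaleE -IHs -linearZ.
- by rewrite -env_mulE -IHs -IHt -rmorphM.
Qed.

End UniversalProperty.
End Enveloping.

(* U(B) regarded as a subalgebra of U(L): the image of the algebra morphism   *)
(* U(B) -> U(L) induced by the inclusion of B in L.                           *)
Definition env_sub (F : fieldType) (L : lieAlgType F) (B : lieSubalg L) :
    set (env L) :=
  range (env_ext (fun x : lie_sub B => env_iota (val x))).

Definition prodspan (F : fieldType) (A : algType F) (X Y : set A) : set A :=
  lspan [set x * y | x in X & y in Y].

Section PlusMinus.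
Variables (F : fieldType) (L : lieAlgType F).

Definition plus_minus_pair (P M : lieSubalg L) : Prop :=
  [set x + y | x in P & y in M] <> [set: L] /\
  prodspan (prodspan (env_sub P) (env_sub M)) (env_sub P) = [set: env L].

Definition regular_pair (P M : lieSubalg L) : Prop :=
  P `&` M = [set 0] /\
  exists sigma : {linear L -> L},
    [/\ lie_morphism sigma, sigma \o sigma =1 id, ~ (sigma =1 id)
      & sigma @` P = M].

Definition has_plus_minus_pair : Prop :=
  exists P M : lieSubalg L, plus_minus_pair P M.

Definition has_regular_plus_minus_pair : Prop :=
  exists P M : lieSubalg L, plus_minus_pair P M /\ regular_pair P M.

End PlusMinus.

Arguments has_plus_minus_pair {F} L.
Arguments has_regular_plus_minus_pair {F} L.

Definition borcherds_matrix (R : realType) (l : nat) (A : 'M[R]_l) : Prop :=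
  [/\ forall i, A i i = 2 \/ A i i <= 0,
      forall i j, i != j -> A i j <= 0,
      forall i j, A i i = 2 -> A i j \is a Num.int
    & forall i j, A i j = 0 -> A j i = 0].

Definition kac_moody_matrix (R : realType) (l : nat) (A : 'M[R]_l) : Prop :=
  (forall i, A i i = 2) /\ (forall i j, A i j \is a Num.int).

(* The Lie algebra generated by the vector space H and the e_i, f_i with the  *)
(* defining relations of g~: formal expressions modulo the least congruence   *)
(* imposing the Lie algebra axioms, the linearity of H -> g~ and the          *)
(* relations.                                                                 *)
Section Tilde.
Variables (F : fieldType) (l : nat) (H : vectType F).
Variables (hv : 'I_l -> H) (alpha : 'I_l -> 'Hom(H, F^o)).

Inductive gterm : Type :=
| GH of H
| GE of 'I_l
| GF of 'I_l
| GZero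
| GAdd of gterm & gterm
| GOpp of gterm
| GScale of F & gterm
| GLie of gterm & gterm.

Inductive geq : gterm -> gterm -> Prop :=
| geq_refl t : geq t t
| geq_sym s t : geq s t -> geq t s
| geq_trans s t u : geq s t -> geq t u -> geq s u
| geq_add s s' t t' : geq s s' -> geq t t' -> geq (GAdd s t) (GAdd s' t')
| geq_opp s s' : geq s s' -> geq (GOpp s) (GOpp s')
| geq_scale a s s' : geq s s' -> geq (GScale a s) (GScale a s')
| geq_lie s s' t t' : geq s s' -> geq t t' -> geq (GLie s t) (GLie s' t')
| geq_addA s t u : geq (GAdd s (GAdd t u)) (GAdd (GAdd s t) u)
| geq_addC s t : geq (GAdd s t) (GAdd t s)
| geq_add0 s : geq (GAdd GZero s) s
| geq_addN s : geq (GAdd (GOpp s) s) GZero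
| geq_scaleA a b s : geq (GScale a (GScale b s)) (GScale (a * b) s)
| geq_scale1 s : geq (GScale 1 s) s
| geq_scaleDr a s t : geq (GScale a (GAdd s t)) (GAdd (GScale a s) (GScale a t))
| geq_scaleDl a b s : geq (GScale (a + b) s) (GAdd (GScale a s) (GScale b s))
| geq_linearl a s t u :
    geq (GLie (GAdd (GScale a s) t) u) (GAdd (GScale a (GLie s u)) (GLie t u))
| geq_linearr a s t u :
    geq (GLie u (GAdd (GScale a s) t)) (GAdd (GScale a (GLie u s)) (GLie u t))
| geq_xx s : geq (GLie s s) GZero
| geq_jacobi s t u :
    geq (GAdd (GAdd (GLie s (GLie t u)) (GLie t (GLie u s)))
              (GLie u (GLie s t))) GZero
| geq_H a h k : geq (GH (a *: h + k)) (GAdd (GScale a (GH h)) (GH k))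
| geq_HH h k : geq (GLie (GH h) (GH k)) GZero
| geq_HE h i : geq (GLie (GH h) (GE i)) (GScale (alpha i h) (GE i))
| geq_HF h i : geq (GLie (GH h) (GF i)) (GScale (- alpha i h) (GF i))
| geq_EF i j : geq (GLie (GE i) (GF j)) (if i == j then GH (hv i) else GZero).

HB.instance Definition _ := gen_eqMixin gterm.
HB.instance Definition _ := gen_choiceMixin gterm.

Definition geqb : rel gterm := fun s t => `[< geq s t >].

Fact geqb_equiv : equiv_class_of geqb.
Proof.
split=> [t|s t|t s u].
- by apply/asboolP/geq_refl.
- by apply/asboolP/asboolP => /geq_sym.
- by move=> /asboolP st /asboolP tu; apply/asboolP/(geq_trans st tu).
Qed.

Canonical geqb_equiv_rel := EquivRelPack geqb_equiv.

Definition gtilde := {eq_quot geqb}.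
HB.instance Definition _ := Choice.on gtilde.
HB.instance Definition _ := Quotient.on gtilde.

Lemma gtilde_piP s t : geq s t <-> \pi_gtilde s = \pi_gtilde t.
Proof.
split=> [st|/eqmodP/asboolP//].
by apply/eqmodP/asboolP.
Qed.

Lemma gtilde_repr t : geq (repr (\pi_gtilde t)) t.
Proof. by apply/gtilde_piP; rewrite reprK. Qed.

Lemma gtilde_ind (P : gtilde -> Prop) :
  (forall t, P (\pi_gtilde t)) -> forall u, P u.
Proof. by move=> HP u; rewrite -[u]reprK. Qed.

Definition gtilde_add (u v : gtilde) : gtilde :=
  \pi_gtilde (GAdd (repr u) (repr v)).
Definition gtilde_opp (u : gtilde) : gtilde :=
  \pi_gtilde (GOpp (repr u)).
Definition gtilde_scale a (u : gtilde) : gtilde :=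
  \pi_gtilde (GScale a (repr u)).
Definition gtilde_lie (u v : gtilde) : gtilde :=
  \pi_gtilde (GLie (repr u) (repr v)).

Lemma gtilde_addE s t : gtilde_add (\pi_gtilde s) (\pi_gtilde t) =
  \pi_gtilde (GAdd s t).
Proof. by apply/gtilde_piP/geq_add; apply: gtilde_repr. Qed.
Lemma gtilde_oppE s : gtilde_opp (\pi_gtilde s) = \pi_gtilde (GOpp s).
Proof. by apply/gtilde_piP/geq_opp; apply: gtilde_repr. Qed.
Lemma gtilde_scaleE a s : gtilde_scale a (\pi_gtilde s) =
  \pi_gtilde (GScale a s).
Proof. by apply/gtilde_piP/geq_scale; apply: gtilde_repr. Qed.
Lemma gtilde_lieE s t : gtilde_lie (\pi_gtilde s) (\pi_gtilde t) =
  \pi_gtilde (GLie s t).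
Proof. by apply/gtilde_piP/geq_lie; apply: gtilde_repr. Qed.

Definition gtilde_opE := (gtilde_addE, gtilde_oppE, gtilde_scaleE, gtilde_lieE).

Fact gtilde_addA : associative gtilde_add.
Proof.
elim/gtilde_ind=> s; elim/gtilde_ind=> t; elim/gtilde_ind=> u.
rewrite !gtilde_opE; exact/gtilde_piP/geq_addA.
Qed.
Fact gtilde_addC : commutative gtilde_add.
Proof.
elim/gtilde_ind=> s; elim/gtilde_ind=> t.
rewrite !gtilde_opE; exact/gtilde_piP/geq_addC.
Qed.
Fact gtilde_add0 : left_id (\pi_gtilde GZero) gtilde_add.
Proof. elim/gtilde_ind=> s; rewrite !gtilde_opE; exact/gtilde_piP/geq_add0. Qed.
Fact gtilde_addN : left_inverse (\pi_gtilde GZero) gtilde_opp gtilde_add.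
Proof. elim/gtilde_ind=> s; rewrite !gtilde_opE; exact/gtilde_piP/geq_addN. Qed.

HB.instance Definition _ := GRing.isZmodule.Build gtilde
  gtilde_addA gtilde_addC gtilde_add0 gtilde_addN.

Fact gtilde_scaleA a b (u : gtilde) :
  gtilde_scale a (gtilde_scale b u) = gtilde_scale (a * b) u.
Proof.
elim/gtilde_ind: u => s; rewrite !gtilde_opE; exact/gtilde_piP/geq_scaleA.
Qed.
Fact gtilde_scale1 : left_id 1 gtilde_scale.
Proof.
elim/gtilde_ind=> s; rewrite !gtilde_opE; exact/gtilde_piP/geq_scale1.
Qed.
Fact gtilde_scaleDr : right_distributive gtilde_scale +%R.
Proof.
move=> a; elim/gtilde_ind=> s; elim/gtilde_ind=> t.
rewrite -[LHS]/(gtilde_scale a (gtilde_add _ _)) -[RHS]/(gtilde_add _ _).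
rewrite !gtilde_opE; exact/gtilde_piP/geq_scaleDr.
Qed.
Fact gtilde_scaleDl u : {morph gtilde_scale^~ u : a b / a + b}.
Proof.
move=> a b /=; elim/gtilde_ind: u => s.
rewrite -[RHS]/(gtilde_add _ _) !gtilde_opE; exact/gtilde_piP/geq_scaleDl.
Qed.

HB.instance Definition _ := GRing.Zmodule_isLmodule.Build F gtilde
  gtilde_scaleA gtilde_scale1 gtilde_scaleDr gtilde_scaleDl.

Fact gtilde_linearl a x y z :
  gtilde_lie (a *: x + y) z = a *: gtilde_lie x z + gtilde_lie y z.
Proof.
elim/gtilde_ind: x => s; elim/gtilde_ind: y => t; elim/gtilde_ind: z => u.
rewrite -[LHS]/(gtilde_lie (gtilde_add (gtilde_scale _ _) _) _).
rewrite -[RHS]/(gtilde_add (gtilde_scale _ _) _).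
rewrite !gtilde_opE; exact/gtilde_piP/geq_linearl.
Qed.
Fact gtilde_linearr a x y z :
  gtilde_lie z (a *: x + y) = a *: gtilde_lie z x + gtilde_lie z y.
Proof.
elim/gtilde_ind: x => s; elim/gtilde_ind: y => t; elim/gtilde_ind: z => u.
rewrite -[LHS]/(gtilde_lie _ (gtilde_add (gtilde_scale _ _) _)).
rewrite -[RHS]/(gtilde_add (gtilde_scale _ _) _).
rewrite !gtilde_opE; exact/gtilde_piP/geq_linearr.
Qed.
Fact gtilde_xx x : gtilde_lie x x = 0.
Proof.
elim/gtilde_ind: x => s; rewrite !gtilde_opE; exact/gtilde_piP/geq_xx.
Qed.
Fact gtilde_jacobi x y z :
  gtilde_lie x (gtilde_lie y z) + gtilde_lie y (gtilde_lie z x)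
    + gtilde_lie z (gtilde_lie x y) = 0.
Proof.
elim/gtilde_ind: x => s; elim/gtilde_ind: y => t; elim/gtilde_ind: z => u.
rewrite -[LHS]/(gtilde_add (gtilde_add _ _) _).
rewrite !gtilde_opE; exact/gtilde_piP/geq_jacobi.
Qed.

HB.instance Definition _ := Lmodule_isLieAlgebra.Build F gtilde
  gtilde_linearl gtilde_linearr gtilde_xx gtilde_jacobi.

Definition tilde_h (h : H) : gtilde := \pi_gtilde (GH h).
Definition tilde_e (i : 'I_l) : gtilde := \pi_gtilde (GE i).
Definition tilde_f (i : 'I_l) : gtilde := \pi_gtilde (GF i).

(* homogeneous d x: x lies in the component of degree d, where Z^l = 'rV_l    *)
(* carries the basis eps_i = delta_mx 0 i. The grading is the least family of *)
(* subspaces compatible with the bracket and with the degrees of generators.  *)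
Inductive homogeneous : 'rV[int]_l -> gtilde -> Prop :=
| homogeneous_h h : homogeneous 0 (tilde_h h)
| homogeneous_e i : homogeneous (delta_mx 0 i) (tilde_e i)
| homogeneous_f i : homogeneous (- delta_mx 0 i) (tilde_f i)
| homogeneous0 d : homogeneous d 0
| homogeneousD d a x y :
    homogeneous d x -> homogeneous d y -> homogeneous d (a *: x + y)
| homogeneous_lie c d x y :
    homogeneous c x -> homogeneous d y -> homogeneous (c + d) [lie x, y].

Definition graded_ideal (I : set gtilde) : Prop :=
  lie_ideal I /\ I `<=` lspan (I `&` [set x | exists d, homogeneous d x]).

Definition graded_ideal_off_h (I : set gtilde) : Prop :=
  graded_ideal I /\ I `&` range tilde_h = [set 0].

(* p exhibits g as the quotient of g~ by its largest graded ideal meeting H   *)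
(* trivially.                                                                 *)
Definition borcherds_quotient (g : lieAlgType F) (p : gtilde -> g) : Prop :=
  [/\ lie_morphism p, range p = [set: g],
      graded_ideal_off_h (p @^-1` [set 0])
    & forall I, graded_ideal_off_h I -> I `<=` p @^-1` [set 0]].

Definition cartan (g : lieAlgType F) (p : gtilde -> g) : set g :=
  range (p \o tilde_h).
Definition g_plus (g : lieAlgType F) (p : gtilde -> g) : lieSubalg g :=
  gen_subalg (range (p \o tilde_e)).
Definition g_minus (g : lieAlgType F) (p : gtilde -> g) : lieSubalg g :=
  gen_subalg (range (p \o tilde_f)).

End Tilde.

Arguments tilde_h {F l H} hv alpha h.
Arguments tilde_e {F l H} hv alpha i.
Arguments tilde_f {F l H} hv alpha i.

(* Main.v *)
Require Import Defs.
From HB Require Import structures.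
From mathcomp Require Import all_boot all_algebra.
From mathcomp Require Import boolp classical_sets reals ring.

Set Implicit Arguments.
Unset Strict Implicit.
Unset Printing Implicit Defensive.

Import GRing.Theory.

Local Open Scope ring_scope.
Local Open Scope classical_set_scope.

(* The key point is a property of U = U(g). Let S be a subspace of U that is  *)
(* stable under left and right multiplication by the e_i and contains         *)
(* U(g_-)U(h''). Then S is stable under ad e_i, and ad e_i sends an f-word w  *)
(* times y in U(h) to (d_i w) h_i y, modulo terms with fewer factors h_j or   *)
(* with a factor e_i on the right, where d_i is the derivation of the free    *)
(* algebra with d_i f_j = delta_ij. In characteristic zero d_i is onto, so by *)
(* induction on the number of factors h_j one gets U(g_-)U(h')U(h'') inside   *)
(* S, hence S = U. This applies to S = U(g_+)U(g_-)U(h'')U(g_+), and with e   *)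
(* and f exchanged.                                                           *)
(*                                                                            *)
(* It remains to see that h' is spanned by the h_i and that h, g_+ and g_-    *)
(* are independent. The automorphism e_i -> 2 e_i, f_i -> f_i / 2 descends to *)
(* g and acts on h, g_+, g_- with eigenvalues 1, 2^n, 2^-n (n > 0), which     *)
(* gives the independence; [g, g] is contained in the ideal g_+ + g_- +       *)
(* span(h_i). A dual Verma module shows that h embeds in g~. The involution   *)
(* e_i -> -f_i, f_i -> -e_i, h -> -h makes the pair regular.                  *)

(** Both factorizations come from [straightening], which is stated for any associative algebra
    generated by elements satisfying the relations of e_i, f_i and h. The second is thus the first
    with e and f exchanged and the signs of coroots and roots reversed. The complement h'' enters
    through h = span(h_i) + h'', which [cartan_derived] extracts from [derived_sub] and from the
    independence statement [quot_direct].

    If g is perfect, h is spanned by the h_i, so U(h'') may be replaced with U(B) for any subalgebra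
    B. Taking B = g_- gives U(g) = U(g_+)U(g_-)U(g_-)U(g_+) = U(g_+)U(g_-)U(g_+). A coroot is not in
    g_+ + g_-, so (g_+, g_-) is a plus-minus pair, and [quot_involution] makes it regular. *)

Section Subspaces.
Variables (F : fieldType) (V : lmodType F).
Implicit Types (B S : set V) (x y : V).

Lemma subspaceD B x y : subspace B -> B x -> B y -> B (x + y).
Proof. by move=> [_ sB] Bx By; rewrite -[x]scale1r; apply: sB. Qed.

Lemma subspaceZ B a x : subspace B -> B x -> B (a *: x).
Proof. by move=> [B0 sB] Bx; rewrite -[_ *: _]addr0; apply: sB. Qed.

Lemma subspaceB B x y : subspace B -> B x -> B y -> B (x - y).
Proof. by move=> [_ sB] Bx By; rewrite addrC -scaleN1r; apply: sB. Qed.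

Lemma subspace_sum B (J : Type) (r : seq J) (P : pred J) (G : J -> V) :
  subspace B -> (forall j, P j -> B (G j)) -> B (\sum_(j <- r | P j) G j).
Proof.
move=> sB BG; elim/big_ind: _ => //; first by case: sB.
by move=> x y; apply: subspaceD.
Qed.

Lemma lspan_subspace S : subspace (lspan S).
Proof.
split=> [B [[]]//|a x y Sx Sy B [sB SB]].
by apply: sB.2; [apply: Sx|apply: Sy].
Qed.

Lemma sub_lspan S : S `<=` lspan S.
Proof. by move=> x Sx B [_]; apply. Qed.

Lemma lspan_min S B : subspace B -> S `<=` B -> lspan S `<=` B.
Proof. by move=> sB SB x; apply. Qed.

Lemma subspace_preimage (W : lmodType F) (u : W -> V) B :
  linear u -> subspace B -> subspace (u @^-1` B).
Proof.
move=> lu [B0 sB]; split; last by move=> a x y /= Bx By; rewrite lu; apply: sB.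
by have := lu (-1) 0 0; rewrite /preimage /= scaleN1r addNr => ->; rewrite scaleN1r addNr.
Qed.

Lemma subspace_add B C : subspace B -> subspace C ->
  subspace [set x + y | x in B & y in C].
Proof.
move=> sB sC; split; first by exists 0; [case: sB|exists 0; [case: sC|rewrite addr0]].
move=> a _ _ [b Bb [c Cc <-]] [b' Bb' [c' Cc' <-]].
exists (a *: b + b'); first exact: sB.2.
by exists (a *: c + c'); [apply: sC.2|rewrite scalerDr addrACA].
Qed.

End Subspaces.

(** * Products of subspaces of an algebra *)

Section ProductSpans.
Variables (F : fieldType) (A : algType F).
Implicit Types X Y : set A.

Lemma prodspan_subspace X Y : subspace (prodspan X Y).
Proof. exact: lspan_subspace. Qed.

Lemma mem_prodspan X Y x y : X x -> Y y -> prodspan X Y (x * y).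
Proof. by move=> Xx Yy; apply: sub_lspan; exists x => //; exists y. Qed.

Lemma prodspan_mull X Y a : (forall x, X x -> X (a * x)) ->
  forall z, prodspan X Y z -> prodspan X Y (a * z).
Proof.
move=> Xa; apply: lspan_min.
  apply: (@subspace_preimage _ _ _ ( *%R a)); last exact: prodspan_subspace.
  by move=> c u v; rewrite mulrDr -scalerAr.
by move=> _ [x Xx [y Yy <-]] /=; rewrite mulrA; apply: mem_prodspan; auto.
Qed.

Lemma prodspan_mulr X Y a : (forall y, Y y -> Y (y * a)) ->
  forall z, prodspan X Y z -> prodspan X Y (z * a).
Proof.
move=> Ya; apply: lspan_min.
  apply: (@subspace_preimage _ _ _ ( *%R^~ a)); last exact: prodspan_subspace.
  by move=> c u v; rewrite mulrDl -scalerAl.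
by move=> _ [x Xx [y Yy <-]] /=; rewrite -mulrA; apply: mem_prodspan; auto.
Qed.

End ProductSpans.

(** * Independence of eigenvectors with disjoint sets of eigenvalues *)

Section Eigenvectors.
Variables (F : fieldType) (V : lmodType F) (T : {linear V -> V}).
Implicit Types (s : seq F) (x y : V) (P Q : set F).

Definition eigenspan P : set V :=
  lspan [set x | exists2 c, P c & T x = c *: x].

(** The polynomial prod_(c in s) (T - c) in [T], applied to x. Every member of an [eigenspan] is
    killed by such a product, also when V has infinite dimension. *)
Fixpoint prod_shift s x := if s is c :: s' then prod_shift s' (T x - c *: x) else x.

Lemma prod_shiftP s a x y :
  prod_shift s (a *: x + y) = a *: prod_shift s x + prod_shift s y.
Proof.
elim: s x y => //= c s IH x y; rewrite -IH linearP scalerBr scalerDr.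
by rewrite opprD addrACA !scalerA [c * a]mulrC.
Qed.

Lemma prod_shift0 s : prod_shift s 0 = 0.
Proof. by elim: s => //= c s IH; rewrite linear0 scaler0 subr0. Qed.

Lemma prod_shift_cat s s' x : prod_shift (s ++ s') x = prod_shift s' (prod_shift s x).
Proof. by elim: s x => /=. Qed.

Lemma prod_shift_comm s s' x :
  prod_shift s (prod_shift s' x) = prod_shift s' (prod_shift s x).
Proof.
have shiftT u y : prod_shift u (T y) = T (prod_shift u y).
  by elim: u y => //= c u IH y; rewrite -IH linearB (linearZ_LR T).
elim: s x => //= c s IH x; rewrite -IH; congr (prod_shift s _).
by rewrite ![_ - _]addrC -!scaleNr prod_shiftP shiftT.
Qed.

Lemma prod_shift_eigen s c x :
  T x = c *: x -> prod_shift s x = (\prod_(b <- s) (c - b)) *: x.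
Proof.
move=> Tx; elim: s => [|b s IH] /=; first by rewrite big_nil scale1r.
rewrite big_cons Tx -scalerBl -[_ *: x]addr0 prod_shiftP prod_shift0 addr0.
by rewrite IH scalerA.
Qed.

(** For c the head of s, the vector (T - c)x is killed by the rest of s and by s', so it vanishes by
    induction. Then x is an eigenvector for c, and prod_(b in s') (c - b) is nonzero. *)
Lemma prod_shift_disjoint s s' x :
  (forall c, c \in s -> c \notin s') ->
  prod_shift s x = 0 -> prod_shift s' x = 0 -> x = 0.
Proof.
elim: s x => //= c s IH x dis sx s'x.
have Tx : T x = c *: x.
  apply/subr0_eq/IH => //; first by move=> b bs; apply: dis; rewrite inE bs orbT.
  by rewrite -[LHS]/(prod_shift s' (prod_shift [:: c] x)) prod_shift_comm s'x prod_shift0.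
move/eqP: s'x; rewrite (prod_shift_eigen _ Tx) scaler_eq0 => /orP[|/eqP //].
rewrite prodf_seq_eq0 => /hasP[b bs' /=]; rewrite subr_eq0 => /eqP cb.
by have := dis c; rewrite inE eqxx cb bs' => /(_ isT).
Qed.

Lemma eigenspan_prod_shift P x : eigenspan P x ->
  exists2 s, (forall c, c \in s -> P c) & prod_shift s x = 0.
Proof.
move: x; apply: lspan_min.
  split; first by exists [::].
  move=> a x y [s Ps sx] [s' Ps' s'y]; exists (s ++ s').
    by move=> c; rewrite mem_cat => /orP[/Ps|/Ps'].
  rewrite prod_shift_cat prod_shiftP sx scaler0 add0r prod_shift_comm s'y.
  exact: prod_shift0.
move=> x [c Pc Tx]; exists [:: c] => [b|/=]; last by rewrite Tx subrr.
by rewrite inE => /eqP->.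
Qed.

Lemma eigenspan_disjoint P Q x :
  P `&` Q `<=` set0 -> eigenspan P x -> eigenspan Q x -> x = 0.
Proof.
move=> PQ /eigenspan_prod_shift[s Ps sx] /eigenspan_prod_shift[s' Qs' s'x].
apply: (prod_shift_disjoint _ sx s'x) => c cs; apply/negP => cs'.
by apply: (PQ c); split; [apply: Ps|apply: Qs'].
Qed.

Lemma eigenspanS P Q : P `<=` Q -> eigenspan P `<=` eigenspan Q.
Proof.
move=> PQ; apply: lspan_min; first exact: lspan_subspace.
by move=> x [c /PQ Qc Tx]; apply: sub_lspan; exists c.
Qed.

End Eigenvectors.

(** * Bracket identities and generated subalgebras *)

Section LieLemmas.
Variables (F : fieldType) (L : lieAlgType F).
Implicit Types (x y z : L) (B : set L).

Lemma lie0r x : [lie x, 0] = 0.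
Proof. by have := lie_linearr (-1) 0 0 x; rewrite !scaleN1r !addNr. Qed.

Lemma lie0l x : [lie 0, x] = 0.
Proof. by have := lie_linearl (-1) 0 0 x; rewrite !scaleN1r !addNr. Qed.

Lemma lieDr x y z : [lie z, x + y] = [lie z, x] + [lie z, y].
Proof. by have := lie_linearr 1 x y z; rewrite !scale1r. Qed.

Lemma lieDl x y z : [lie x + y, z] = [lie x, z] + [lie y, z].
Proof. by have := lie_linearl 1 x y z; rewrite !scale1r. Qed.

Lemma lieZr a x z : [lie z, a *: x] = a *: [lie z, x].
Proof. by have := lie_linearr a x 0 z; rewrite lie0r !addr0. Qed.

Lemma lieZl a x z : [lie a *: x, z] = a *: [lie x, z].
Proof. by have := lie_linearl a x 0 z; rewrite lie0l !addr0. Qed.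

Lemma lieNr x z : [lie z, - x] = - [lie z, x].
Proof. by rewrite -scaleN1r lieZr scaleN1r. Qed.

Lemma lieNl x z : [lie - x, z] = - [lie x, z].
Proof. by rewrite -scaleN1r lieZl scaleN1r. Qed.

Lemma lieC x y : [lie x, y] = - [lie y, x].
Proof.
have := lie_xx (x + y); rewrite lieDl !lieDr !lie_xx add0r addr0 => /eqP.
by rewrite addr_eq0 => /eqP.
Qed.

Lemma lie_derivation x y z :
  [lie x, [lie y, z]] = [lie [lie x, y], z] + [lie y, [lie x, z]].
Proof.
have /eqP := lie_jacobi x y z.
rewrite -addrA addr_eq0 => /eqP->.
by rewrite opprD [[lie z, x]]lieC lieNr opprK addrC [[lie z, _]]lieC opprK.
Qed.

Lemma subspace_adl B x : subspace B -> subspace [set y | B [lie x, y]].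
Proof.
move=> [B0 sB]; split; first by rewrite /= lie0r.
by move=> a y z By Bz; rewrite /= lie_linearr; apply: sB.
Qed.

Lemma gen_subalg_min (S B : set L) :
  lie_subalgebra B -> S `<=` B -> gen_subalg S `<=` B.
Proof. by move=> lB SB x; apply. Qed.

Lemma sub_gen_subalg (S : set L) : S `<=` gen_subalg S.
Proof. by move=> x Sx B [_]; apply. Qed.

Lemma lspan_lie (S S' B : set L) : subspace B ->
  (forall x y, S x -> S' y -> B [lie x, y]) ->
  forall x y, lspan S x -> lspan S' y -> B [lie x, y].
Proof.
move=> sB SS'B x y Sx; move: y; apply: lspan_min; first exact: subspace_adl.
move=> y S'y /=; move: x Sx; apply: lspan_min => [|x Sx]; last exact: SS'B.
split; first by rewrite /= lie0l; case: sB.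
by move=> a x z Bx Bz; rewrite /= lie_linearl; apply: sB.2.
Qed.

(** Eigenvalues of a Lie morphism multiply under the bracket. *)
Lemma eigenspan_lie_subalgebra (T : {linear L -> L}) (P : set F) :
  lie_morphism T -> (forall a b, P a -> P b -> P (a * b)) ->
  lie_subalgebra (eigenspan T P).
Proof.
move=> lT PM; split; first exact: lspan_subspace.
apply: lspan_lie; first exact: lspan_subspace.
move=> x y [a Pa Tx] [b Pb Ty]; apply: sub_lspan; exists (a * b); first exact: PM.
by rewrite lT Tx Ty lieZl lieZr scalerA.
Qed.

End LieLemmas.

(** * Generation of U(L), and U(B) inside it *)

Section EnvelopingLemmas.
Variables (F : fieldType) (L : lieAlgType F).

Section Generation.
Variable G : set L.
Hypothesis genG : gen_subalg G = [set: L] :> set L.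

(** The x in L with [env_iota x] T inside T form a Lie subalgebra, because [env_iota] turns brackets
    into commutators. It contains G, hence is L, and T is a left ideal containing 1. *)
Lemma env_left_ideal_full (T : set (env L)) : subspace T -> T 1 ->
  (forall x u, G x -> T u -> T (env_iota x * u)) -> T = [set: env L].
Proof.
move=> sT T1 TG; rewrite -subTset => u _.
have Tiota x : forall v, T v -> T (env_iota x * v).
  have : subalg_set (gen_subalg G) x by rewrite genG.
  move: x {u}; apply: (gen_subalg_min (B := [set x | forall v, T v -> T (env_iota x * v)])).
    split; first split.
    - move=> v _ /=; have -> : env_iota (0 : L) = 0.
        have := env_iota_linear (-1) (0 : L) 0.
        by rewrite !scaleN1r !addNr.
      by rewrite mul0r; case: sT.
    - move=> a x y Tx Ty v Tv /=; rewrite env_iota_linear mulrDl -scalerAl.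
      by apply: sT.2; [apply: Tx|apply: Ty].
    - move=> x y Tx Ty v Tv /=; rewrite env_iota_lie mulrBl -!mulrA.
      by apply: subspaceB => //; [apply/Tx/Ty|apply/Ty/Tx].
  by move=> x Gx v Tv; apply: TG.
suff Tmul v : T v -> T (u * v) by rewrite -[u]mulr1; apply: Tmul.
elim/env_ind: u v => t; elim: t => [x||| s IHs t IHt | s IHs | a s IHs | s IHs t IHt] v Tv.
- exact: Tiota.
- by rewrite -[X in X * v]/(0 : env L) mul0r; case: sT.
- by rewrite -[X in X * v]/(1 : env L) mul1r.
- rewrite -env_addE mulrDl.
  by apply: subspaceD => //; [apply: IHs|apply: IHt].
- rewrite -env_oppE mulNr -scaleN1r.
  by apply: subspaceZ => //; apply: IHs.
- rewrite -env_scaleE -scalerAl.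
  by apply: subspaceZ => //; apply: IHs.
- rewrite -env_mulE -mulrA.
  by apply/IHs/IHt.
Qed.

End Generation.

Variable B : lieSubalg L.

Let iotaB (x : lie_sub B) : env L := env_iota (val x).

Let iotaB_linear : linear iotaB.
Proof. by move=> a x y; rewrite /iotaB linearP env_iota_linear. Qed.

Let iotaB_lie x y : iotaB [lie x, y] = iotaB x * iotaB y - iotaB y * iotaB x.
Proof. exact: env_iota_lie. Qed.

Lemma env_sub_iota x : subalg_set B x -> env_sub B (env_iota x).
Proof.
move=> Bx; have Bx' : x \in subalg_pred B by apply/subalg_predP.
exists (env_iota (LieSub Bx')) => //.
exact: (env_ext_iota iotaB_linear iotaB_lie).
Qed.

Lemma env_sub1 : env_sub B 1.
Proof.
by exists 1 => //; case: (env_ext_monoid_morphism iotaB_linear iotaB_lie).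
Qed.

Lemma env_subM u v : env_sub B u -> env_sub B v -> env_sub B (u * v).
Proof.
move=> [u' _ <-] [v' _ <-]; exists (u' * v') => //.
by case: (env_ext_monoid_morphism iotaB_linear iotaB_lie) => _; apply.
Qed.

Lemma env_sub_subspace : subspace (env_sub B).
Proof.
have linB := env_ext_linear iotaB_linear iotaB_lie.
split=> [|a _ _ [u _ <-] [v _ <-]]; last by exists (a *: u + v) => //; apply: linB.
exists 0 => //; have := linB (-1) 0 0; rewrite scaleN1r addNr => ->.
by rewrite scaleN1r addNr.
Qed.

Lemma env_sub_prod (J : Type) (r : seq J) (P : pred J) (G : J -> env L) :
  (forall j, P j -> env_sub B (G j)) -> env_sub B (\prod_(j <- r | P j) G j).
Proof.
by move=> BG; elim/big_ind: _ => //; [apply: env_sub1|apply: env_subM].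
Qed.

End EnvelopingLemmas.

(** * Straightening in the enveloping algebra *)

Section Straightening.
Variables (F : fieldType) (charF : [pchar F] =i pred0) (A : algType F).
Variables (I : finType) (H : eqType) (hv : I -> H) (alpha : I -> H -> F).
Variables (e f : I -> A) (eta : H -> A).

Hypothesis etaC : forall h k, eta h * eta k = eta k * eta h.
Hypothesis eta_e : forall h i, eta h * e i = e i * eta h + alpha i h *: e i.
Hypothesis eta_f : forall h i, eta h * f i = f i * eta h - alpha i h *: f i.
Hypothesis e_f : forall i j,
  e i * f j = f j * e i + (if i == j then eta (hv i) else 0).

Implicit Types (w u : seq I) (i j : I) (x : H * F) (s : seq (H * F)).

(* Shifted Cartan elements h + c, so that moving e_i or f_i past a word only  *)
(* changes the shifts.                                                        *)
Definition shifted x : A := eta x.1 + x.2%:A.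
Definition f_word w : A := \prod_(i <- w) f i.
Definition h_word s : A := \prod_(x <- s) shifted x.

Lemma f_word_cons i w : f_word (i :: w) = f i * f_word w.
Proof. by rewrite /f_word big_cons. Qed.

Lemma h_word_nil : h_word [::] = 1.
Proof. exact: big_nil. Qed.

Lemma h_word_cons x s : h_word (x :: s) = shifted x * h_word s.
Proof. by rewrite /h_word big_cons. Qed.

Lemma shiftedC x y : shifted x * shifted y = shifted y * shifted x.
Proof.
rewrite /shifted !mulrDl !mulrDr etaC !mulr_algl !mulr_algr.
by rewrite !scalerA [y.2 * _]mulrC addrACA.
Qed.

Lemma shifted_h_word x s : shifted x * h_word s = h_word s * shifted x.
Proof.
elim: s => [|y s IH]; first by rewrite h_word_nil mulr1 mul1r.
by rewrite h_word_cons mulrA shiftedC -!mulrA IH.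
Qed.

Lemma e_shifted i x : e i * shifted x = shifted (x.1, x.2 - alpha i x.1) * e i.
Proof.
rewrite /shifted mulrDr mulrDl eta_e /= scalerBl mulrBl !mulr_algl mulr_algr.
by rewrite addrACA subrr addr0.
Qed.

Lemma shifted_f i h d : shifted (h, d) * f i = f i * shifted (h, d - alpha i h).
Proof.
rewrite /shifted mulrDr mulrDl eta_f /= scalerBl mulrBr !mulr_algl !mulr_algr.
by rewrite -!addrA [- _ + _]addrC.
Qed.

Lemma f_shifted h w :
  exists c, forall d, shifted (h, d) * f_word w = f_word w * shifted (h, d + c).
Proof.
elim: w => [|i w [c IH]]; first by exists 0 => d; rewrite /f_word big_nil mulr1 mul1r addr0.
exists (c - alpha i h) => d; rewrite f_word_cons mulrA.
by rewrite shifted_f -!mulrA IH -addrA [- _ + c]addrC.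
Qed.

Lemma e_h_word i s : exists2 s', map fst s' = map fst s & e i * h_word s = h_word s' * e i.
Proof.
exists [seq (x.1, x.2 - alpha i x.1) | x <- s]; first by rewrite -map_comp; apply: eq_map.
elim: s => [|x s IH]; first by rewrite !h_word_nil mulr1 mul1r.
by rewrite /= !h_word_cons mulrA e_shifted -mulrA IH mulrA.
Qed.

Lemma h_word_e i s : exists s', h_word s * e i = e i * h_word s'.
Proof.
exists [seq (x.1, x.2 + alpha i x.1) | x <- s].
elim: s => [|x s IH]; first by rewrite !h_word_nil mulr1 mul1r.
rewrite /= !h_word_cons -mulrA IH mulrA [in RHS]mulrA e_shifted /= addrK.
by case: x.
Qed.

Lemma h_word_f i s : exists s', h_word s * f i = f i * h_word s'.
Proof.
exists [seq (x.1, x.2 - alpha i x.1) | x <- s].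
elim: s => [|[h d] s IH]; first by rewrite !h_word_nil mulr1 mul1r.
by rewrite /= !h_word_cons -mulrA IH mulrA [in RHS]mulrA shifted_f.
Qed.

(** One word for each occurrence of i in w, with repetitions: their sum is the derivation d_i of the
    free algebra, d_i f_j = delta_ij, applied to w. *)
Fixpoint deletions i w : seq (seq I) :=
  if w is j :: w' then
    (if i == j then [:: w'] else [::]) ++ map (cons j) (deletions i w')
  else [::].

Lemma count_deletions i w u : u \in deletions i w -> (count_mem i u).+1 = count_mem i w.
Proof.
elim: w u => //= j w IH u; rewrite mem_cat => /orP[|/mapP[v /IH vE ->]].
  by case: (i =P j) => // -> /[!inE] /eqP->; rewrite eqxx.
by rewrite /= -vE addnS.
Qed.

(* The commutator of e_i with an f-word is, up to a combination of f-words,   *)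
(* (the i-th partial derivative of the word) * h_i.                           *)
Lemma e_f_word i w : exists2 r, lspan (range f_word) r &
  e i * f_word w = f_word w * e i
    + (\sum_(u <- deletions i w) f_word u * eta (hv i) + r).
Proof.
elim: w => [|j w [r Nr IH]].
  exists 0; first by case: (lspan_subspace (range f_word)).
  by rewrite /f_word !big_nil mulr1 mul1r !addr0.
have Nfr : lspan (range f_word) (f j * r).
  move: r Nr {IH}; apply: lspan_min.
    apply: (@subspace_preimage _ _ _ ( *%R (f j))); last exact: lspan_subspace.
    by move=> c u v; rewrite mulrDr -scalerAr.
  move=> _ [u _ <-]; apply: sub_lspan; exists (j :: u) => //.
  by rewrite f_word_cons.
have [c cE] := f_shifted (hv i) w.
have etaE : eta (hv i) * f_word w = f_word w * eta (hv i) + c *: f_word w.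
  have := cE 0; rewrite /shifted /= scale0r addr0 add0r => ->.
  by rewrite mulrDr mulr_algr.
(* The term in c is the cost of moving h_i to the right of the word w. *)
exists (f j * r + (if i == j then c *: f_word w else 0)).
  apply: (subspaceD (lspan_subspace _)) => //.
  case: eqP => _; last by case: (lspan_subspace (range f_word)).
  apply: (subspaceZ _ (lspan_subspace _)).
  by apply: sub_lspan; exists w.
rewrite f_word_cons mulrA e_f mulrDl -mulrA IH mulrDr -mulrA -!addrA; congr (_ + _).
have delE : \sum_(u <- map (cons j) (deletions i w)) f_word u * eta (hv i) =
    f j * (\sum_(u <- deletions i w) f_word u * eta (hv i)).
  by rewrite big_map mulr_sumr; apply: eq_bigr => u _; rewrite f_word_cons mulrA.
rewrite /= big_cat /= delE mulrDr -!addrA.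
rewrite [RHS]addrCA; congr (_ + _); rewrite [RHS]addrCA; congr (_ + _).
by case: (i == j); rewrite ?big_seq1 ?etaE // big_nil mul0r addr0.
Qed.

(** Leibniz rule d_i(f_i^(a+1) w) = (a+1) f_i^a w + f_i^(a+1) d_i(w). The function G is arbitrary so
    that the induction can absorb a leading letter into it. *)
Lemma sum_deletions_nseq (G : seq I -> A) i a w :
  \sum_(u <- deletions i (nseq a.+1 i ++ w)) G u =
  a.+1%:R *: G (nseq a i ++ w) + \sum_(u <- deletions i w) G (nseq a.+1 i ++ u).
Proof.
elim: a G => [|a IH] G; first by rewrite /= eqxx big_cons big_map scale1r.
rewrite -[nseq a.+2 i ++ w]/(i :: (nseq a.+1 i ++ w)).
rewrite [deletions _ _]/= -[map _ _]/(map _ (deletions i (nseq a.+1 i ++ w))).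
by rewrite eqxx big_cons big_map IH addrA /= -[a.+2]add1n natrD scalerDl scale1r.
Qed.

Variable S : set A.
Hypothesis S_sub : subspace S.
Hypothesis S_el : forall i a, S a -> S (e i * a).
Hypothesis S_er : forall i a, S a -> S (a * e i).

(* Commuting e_i with a word w y in which f_i occurs yields a sum of words    *)
(* with one f_i less, times h_i y; induction on the number of occurrences of  *)
(* f_i then isolates w h_i y, dividing by the number of leading f_i's.        *)
Lemma straighten_step i y y' : e i * y = y' * e i ->
  (forall w, S (f_word w * y)) -> (forall w, S (f_word w * y')) ->
  forall w, S (f_word w * (eta (hv i) * y)).
Proof.
move=> ey Sy Sy'.
have S_del w : S (\sum_(u <- deletions i w) f_word u * (eta (hv i) * y)).
  have [r Nr ew] := e_f_word i w.
  have Sry : S (r * y).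
    move: r Nr {ew}; apply: lspan_min => [|_ [u _ <-]]; last exact: Sy.
    apply: (@subspace_preimage _ _ _ ( *%R^~ y)) => // c u v.
    by rewrite mulrDl -scalerAl.
  have -> : \sum_(u <- deletions i w) f_word u * (eta (hv i) * y)
      = e i * (f_word w * y) - f_word w * y' * e i - r * y.
    rewrite mulrA ew -[f_word w * y' * _]mulrA -ey mulrA -!mulrBl.
    rewrite [f_word w * e i + _]addrC !addrK mulr_suml.
    by apply: eq_bigr => u _; rewrite mulrA.
  apply: subspaceB => //; apply: subspaceB => //; first exact/S_el/Sy.
  exact/S_er/Sy'.
(* The prefix length a varies because the induction hypothesis is used with prefix f_i^(a+1). The
   word wanted then carries the coefficient a+1, nonzero even for a = 0. *)
suff S_nseq n : forall a w, count_mem i w = n -> S (f_word (nseq a i ++ w) * (eta (hv i) * y)).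
  by move=> w; apply: (S_nseq _ 0%N w erefl).
elim: n => [|n IH] a w wn;
  have := S_del (nseq a.+1 i ++ w); rewrite sum_deletions_nseq => S_sum.
  suff del0 : deletions i w = [::].
    move: S_sum; rewrite del0 big_nil addr0 => /(subspaceZ a.+1%:R^-1 S_sub).
    by rewrite scalerK // ((pcharf0P F).1 charF).
  case: (deletions i w) (@count_deletions i w) => // u l /(_ u).
  by rewrite inE eqxx wn => /(_ isT).
have S_tail : S (\sum_(u <- deletions i w) f_word (nseq a.+1 i ++ u) * (eta (hv i) * y)).
  rewrite big_seq; apply: subspace_sum => // u /count_deletions.
  by rewrite wn => -[/IH]; apply.
have := subspaceZ a.+1%:R^-1 S_sub (subspaceB S_sub S_sum S_tail).
by rewrite addrK scalerK // ((pcharf0P F).1 charF).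
Qed.

Variable Z : set H.
Hypothesis S_fz : forall w s, (forall z, z \in map fst s -> Z z) ->
  S (f_word w * h_word s).
Hypothesis eta_span : forall h, exists (c : I -> F) z,
  Z z /\ eta h = \sum_i c i *: eta (hv i) + eta z.

(** Induction on the number of coroot factors. The shifts in s are left free because
    [straighten_step] replaces y by some y' with the same Cartan elements but other shifts. *)
Lemma f_coroot_word js zs s w : (forall z, z \in zs -> Z z) ->
  map fst s = map hv js ++ zs -> S (f_word w * h_word s).
Proof.
move=> Zzs; elim: js s w => [|j js IH] s w; first by move=> sE; apply: S_fz; rewrite sE.
case: s => [|[h c] s] //= [-> sE]; rewrite h_word_cons /shifted /=.
rewrite mulrDl mulrDr mulr_algl -scalerAr.
apply: subspaceD => //; last by apply: subspaceZ => //; apply: IH.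
have [s' s'E es] := e_h_word j s.
by apply: (straighten_step es) => u; apply: IH; rewrite // s'E.
Qed.

Lemma f_h_word s w : S (f_word w * h_word s).
Proof.
(* The word t is already sorted, coroots first and then elements of Z, while s' remains to be
   expanded by [eta_span]. *)
suff S_mixed js zs t s' w' : (forall z, z \in zs -> Z z) -> map fst t = map hv js ++ zs ->
    S (f_word w' * (h_word t * h_word s')).
  by have := S_mixed [::] [::] [::] s w; rewrite h_word_nil mul1r; apply.
elim: s' js zs t w' {s w} => [|[h c] s' IH] js zs t w Zzs tE.
  by rewrite h_word_nil mulr1; apply: f_coroot_word tE.
have [a [z [Zz hE]]] := eta_span h.
(* Coroots go to the front with shift 0; the shift c stays with z, which goes to the end. *)
have -> : h_word t * h_word ((h, c) :: s') =
    \sum_i a i *: (h_word ((hv i, 0) :: t) * h_word s')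
    + h_word (rcons t (z, c)) * h_word s'.
  rewrite h_word_cons mulrA /shifted /= hE mulrDr mulrDr.
  rewrite mulr_sumr !mulrDl mulr_suml -addrA; congr (_ + _).
    apply: eq_bigr => i _; rewrite h_word_cons shifted_h_word.
    by rewrite /shifted /= scale0r addr0 -scalerAr -!scalerAl.
  by rewrite -!mulrDl -mulrDr /h_word -cats1 big_cat big_seq1.
rewrite mulrDr mulr_sumr; apply: subspaceD => //.
  apply: subspace_sum => // i _; rewrite -scalerAr; apply: subspaceZ => //.
  by apply: (IH (i :: js) zs) => //=; rewrite tE.
apply: (IH js (rcons zs z)); last by rewrite map_rcons tE rcons_cat.
by move=> z'; rewrite mem_rcons inE => /predU1P[-> // | /Zzs].
Qed.

Hypothesis A_gen : forall T : set A, subspace T -> T 1 ->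
  (forall i a, T a -> T (e i * a)) -> (forall i a, T a -> T (f i * a)) ->
  (forall h a, T a -> T (eta h * a)) -> T = [set: A].

(** The a such that every f-word times h-word times a lies in S form a left ideal, which contains 1
    by [f_h_word]. It is therefore all of A, and empty words give S = A. *)
Theorem straightening : S = [set: A].
Proof.
pose T := [set a | forall w s, S (f_word w * h_word s * a)].
suff T_full : T = [set: A].
  rewrite -subTset => a _; have : T a by rewrite T_full.
  by move=> /(_ [::] [::]); rewrite h_word_nil /f_word big_nil !mul1r.
have eq_mull a : linear ( *%R a : A -> A) by move=> c u v; rewrite mulrDr -scalerAr.
have eq_mulr a : linear ( *%R^~ a : A -> A) by move=> c u v; rewrite mulrDl -scalerAl.
apply: A_gen => [|w s|i a Ta w s|i a Ta w s|h a Ta w s].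
- split=> [w s|c a b Ta Tb w s]; first by rewrite mulr0; case: S_sub.
  by rewrite eq_mull; apply: S_sub.2; [apply: Ta|apply: Tb].
- by rewrite mulr1; apply: f_h_word.
(* Move e_i left: past the h-word it only changes shifts, and past the f-word it leaves a commutator
   made of f-words times h_i and f-words. Once leftmost, e_i is absorbed by S. *)
- have [s' se] := h_word_e i s.
  have [r Nr ew] := e_f_word i w.
  rewrite mulrA -[_ * h_word s * e i]mulrA se mulrA.
  move/eqP: ew; rewrite -subr_eq => /eqP <-.
  rewrite 2!mulrBl -!mulrA; apply: subspaceB => //.
    by apply: S_el; rewrite mulrA; apply: Ta.
  rewrite mulrDl mulr_suml; apply: subspaceD => //.
    apply: subspace_sum => // u _.
    have := Ta u ((hv i, 0) :: s').
    by rewrite h_word_cons /shifted /= scale0r addr0 -!mulrA.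
  move: r Nr; apply: lspan_min => [|_ [u _ <-]]; last by rewrite /= mulrA; apply: Ta.
  exact: (subspace_preimage (eq_mulr _)).
- have [s' sf] := h_word_f i s.
  have := Ta (rcons w i) s'.
  by rewrite /f_word -cats1 big_cat big_seq1 mulrA -[_ * h_word s * f i]mulrA sf -!mulrA.
- have := Ta w (rcons s (h, 0)).
  by rewrite /h_word -cats1 big_cat big_seq1 /shifted /= scale0r addr0 -!mulrA.
Qed.

End Straightening.

(** * The Lie algebra g~ *)

Section TildeTheory.
Variables (F : fieldType) (l : nat) (H : vectType F).
Variables (hv : 'I_l -> H) (alpha : 'I_l -> 'Hom(H, F^o)).

Local Notation gt := (gtilde hv alpha).
Local Notation th := (tilde_h hv alpha).
Local Notation te := (tilde_e hv alpha).
Local Notation tf := (tilde_f hv alpha).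
Local Notation term := (@gterm F l H).
Local Notation "t %:G" := (\pi_(gt)%qT t) (at level 2, format "t %:G").

Lemma tilde_h_linear : linear th.
Proof.
move=> a h k; rewrite /tilde_h -[RHS]/(gtilde_add (gtilde_scale _ _) _).
by rewrite !gtilde_opE; apply/gtilde_piP/geq_H.
Qed.

Lemma tilde_hh h k : [lie th h, th k] = 0.
Proof.
rewrite -[LHS]/(gtilde_lie _ _) gtilde_opE; exact/gtilde_piP/geq_HH.
Qed.

Lemma tilde_he h i : [lie th h, te i] = (alpha i h : F) *: te i.
Proof.
rewrite -[LHS]/(gtilde_lie _ _) -[RHS]/(gtilde_scale _ _) !gtilde_opE.
exact/gtilde_piP/geq_HE.
Qed.

Lemma tilde_hf h i : [lie th h, tf i] = (- alpha i h : F) *: tf i.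
Proof.
rewrite -[LHS]/(gtilde_lie _ _) -[RHS]/(gtilde_scale _ _) !gtilde_opE.
exact/gtilde_piP/geq_HF.
Qed.

Lemma tilde_ef i j : [lie te i, tf j] = if i == j then th (hv i) else 0.
Proof.
have -> : (if i == j then th (hv i) else 0) = (if i == j then GH l (hv i) else GZero l H)%:G.
  by case: (i == j).
rewrite -[LHS]/(gtilde_lie _ _) gtilde_opE; exact/gtilde_piP/geq_EF.
Qed.

Lemma tilde_gen (B : set gt) : lie_subalgebra B ->
  (forall h, B (th h)) -> (forall i, B (te i)) -> (forall i, B (tf i)) ->
  B = [set: gt].
Proof.
move=> [sB lB] Bh Be Bf; rewrite -subTset => x _; move: x; elim/gtilde_ind.
elim=> [h|i|i||s Bs t Bt|s Bs|c s Bs|s Bs t Bt].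
- exact: Bh.
- exact: Be.
- exact: Bf.
- by case: sB.
- by rewrite -gtilde_addE; apply: (subspaceD sB Bs Bt).
- by have := subspaceZ (-1) sB Bs; rewrite scaleN1r -gtilde_oppE.
- by rewrite -gtilde_scaleE; apply: (subspaceZ _ sB Bs).
- by rewrite -gtilde_lieE; apply: (lB _ _ Bs Bt).
Qed.

Section Extension.
Variables (L : lieAlgType F) (fH : H -> L) (fE fF : 'I_l -> L).

Fixpoint geval (t : term) : L :=
  match t with
  | GH h => fH h
  | GE i => fE i
  | GF i => fF i
  | GZero => 0
  | GAdd s t => geval s + geval t
  | GOpp s => - geval s
  | GScale a s => a *: geval s
  | GLie s t => [lie geval s, geval t]
  end.

Hypothesis fH_linear : linear fH.
Hypothesis fHH : forall h k, [lie fH h, fH k] = 0.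
Hypothesis fHE : forall h i, [lie fH h, fE i] = (alpha i h : F) *: fE i.
Hypothesis fHF : forall h i, [lie fH h, fF i] = (- alpha i h : F) *: fF i.
Hypothesis fEF : forall i j, [lie fE i, fF j] = if i == j then fH (hv i) else 0.

Lemma geq_geval s t : Defs.geq hv alpha s t -> geval s = geval t.
Proof.
elim=> {s t} //=; do ?by move=> *; congruence.
- by move=> *; rewrite addrA.
- by move=> *; rewrite addrC.
- by move=> *; rewrite add0r.
- by move=> *; rewrite addNr.
- by move=> *; rewrite scalerA.
- by move=> *; rewrite scale1r.
- by move=> *; rewrite scalerDr.
- by move=> *; rewrite scalerDl.
- by move=> *; rewrite lie_linearl.
- by move=> *; rewrite lie_linearr.
- by move=> *; rewrite lie_xx.
- by move=> *; rewrite lie_jacobi.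
- by move=> i j; rewrite fEF; case: (i == j).
Qed.

(** The universal property of g~, from which the scaling and the involution are built. *)
Lemma tilde_extension : exists phi : {linear gt -> L},
  [/\ lie_morphism phi, forall h, phi (th h) = fH h,
      forall i, phi (te i) = fE i & forall i, phi (tf i) = fF i].
Proof.
pose phi (x : gt) := geval (repr x).
have phiE t : phi t%:G = geval t by apply/geq_geval/gtilde_repr.
have phi_linear : linear phi.
  move=> a x y; rewrite -[_ + _ in LHS]/(gtilde_add (gtilde_scale _ _) _) phiE /=.
  by congr (_ + _); apply: (phiE (GScale a (repr x))).
pose m := GRing.isLinear.Build F gt L _ phi phi_linear.
pose Phi : {linear gt -> L} := HB.pack phi m.
exists Phi; split=> [x y|h|i|i].
- exact: (phiE (GLie (repr x) (repr y))).
- exact: (phiE (GH l h)).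
- exact: (phiE (GE H i)).
- exact: (phiE (GF H i)).
Qed.

End Extension.

(* The dual of a Verma module of g~: functions on words in the f_i, on which  *)
(* h acts through the weight lambda - sum_(i in w) alpha_i of the word w, e_i *)
(* by the transpose of prepending i, and f_i by the transpose of the action   *)
(* of e_i.                                                                    *)
Section Verma.
Variable lambda : 'Hom(H, F^o).

Implicit Types (w : seq 'I_l) (u v : seq 'I_l -> F).

Fixpoint weight w h : F :=
  if w is i :: w' then weight w' h - alpha i h else lambda h.

Fixpoint verma_f i w u : F :=
  if w is j :: w' then
    verma_f i w' (fun w'' => u (j :: w''))
      + (if i == j then weight w' (hv i) * u w' else 0)
  else 0.

Fixpoint verma (t : term) u w : F :=
  match t with
  | GH h => weight w h * u w
  | GE i => u (i :: w)
  | GF i => verma_f i w u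
  | GZero => 0
  | GAdd s t => verma s u w + verma t u w
  | GOpp s => - verma s u w
  | GScale a s => a * verma s u w
  | GLie s t => verma s (verma t u) w - verma t (verma s u) w
  end.

Lemma weight_linear w a h k : weight w (a *: h + k) = a * weight w h + weight w k.
Proof.
elim: w => [|i w IH] /=; first by rewrite linearP.
by rewrite IH linearP /= [_ *: _]/(_ * _) mulrBr opprD addrACA.
Qed.

Lemma verma_f_linear i w a u v :
  verma_f i w (fun w => a * u w + v w) = a * verma_f i w u + verma_f i w v.
Proof.
elim: w u v => [|j w IH] u v /=; first by rewrite mulr0 addr0.
rewrite IH; case: ifP => _; last by rewrite !addr0.
by rewrite !mulrDr mulrCA addrACA.
Qed.

Lemma verma_linear t a u v w :
  verma t (fun w => a * u w + v w) w = a * verma t u w + verma t v w.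
Proof.
elim: t a u v w => [h|i|i||s IHs t IHt|s IHs|c s IHs|s IHs t IHt] a u v w //=.
- by rewrite mulrDr mulrCA.
- exact: verma_f_linear.
- by rewrite mulr0 addr0.
- by rewrite IHs IHt mulrDr addrACA.
- by rewrite IHs opprD mulrN.
- by rewrite IHs mulrDr mulrCA.
- have eqt : verma t (fun w => a * u w + v w) = fun w => a * verma t u w + verma t v w.
    by apply/funext => w'; apply: IHt.
  have eqs : verma s (fun w => a * u w + v w) = fun w => a * verma s u w + verma s v w.
    by apply/funext => w'; apply: IHs.
  by rewrite eqt eqs IHs IHt mulrBr opprD addrACA.
Qed.

Lemma vermaB t u v w :
  verma t (fun w => u w - v w) w = verma t u w - verma t v w.
Proof.
have -> : (fun w => u w - v w) = (fun w => - 1 * v w + u w).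
  by apply/funext => w'; rewrite mulN1r addrC.
by rewrite verma_linear mulN1r addrC.
Qed.

Lemma verma_f_weight i w h u :
  verma_f i w (fun w => weight w h * u w) = (weight w h + alpha i h) * verma_f i w u.
Proof.
elim: w u => [|j w IH] u /=; first by rewrite mulr0.
have -> : (fun w => (weight w h - alpha j h) * u (j :: w)) =
    (fun w => - alpha j h * u (j :: w) + weight w h * u (j :: w)).
  by apply/funext => w'; rewrite mulrBl mulNr addrC.
rewrite (verma_f_linear i w (- alpha j h) (fun w => u (j :: w))) IH -mulrDl.
rewrite [RHS]mulrDr -addrA; congr (_ * _ + _).
  by rewrite addrCA addrA.
case: eqP => [<-|_]; last by rewrite mulr0.
by rewrite addNr addr0 mulrCA.
Qed.

Lemma geq_verma s t : Defs.geq hv alpha s t -> verma s = verma t.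
Proof.
elim=> {s t}; try by move=> *; congruence.
all: move=> *; apply/funext => u; apply/funext => w /=.
all: rewrite ?verma_linear ?vermaB ?weight_linear ?verma_f_weight; try by [congruence|ring].
(* What remains is [e_i, f_j] = delta_ij h_i, which the recursive clause of [verma_f] encodes. *)
by rewrite addrAC subrr add0r eq_sym; case: eqP => [->|].
Qed.

Lemma tilde_h_weight h : th h = 0 -> lambda h = 0.
Proof.
move=> /gtilde_piP/geq_verma/(congr1 (fun P => P (fun=> 1) [::])) /=.
by rewrite mulr1.
Qed.

End Verma.

(** Every linear form on H occurs as a highest weight; the coordinate forms separate the points of
    H. *)
Lemma tilde_h_inj h : th h = 0 -> h = 0.
Proof.
move=> h0; rewrite (coord_vbasis (memvf h)) big1 // => i _.
pose lambda (k : H) : F^o := coord (vbasis {:H}) i k.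
have lambda_linear : linear lambda by move=> a x y; rewrite /lambda linearP.
pose m := GRing.isLinear.Build F H F^o _ lambda lambda_linear.
pose Lambda : {linear H -> F^o} := HB.pack lambda m.
have := @tilde_h_weight (linfun Lambda) h h0.
by rewrite lfunE /= /lambda => ->; rewrite scale0r.
Qed.

End TildeTheory.

(** * Bracketing a generated subalgebra with an outside element *)

Section Normalizers.
Variables (F : fieldType) (L : lieAlgType F).
Implicit Types (S C : set L) (x y : L).

(** Since ad x is a derivation, stability need only be checked on generators. *)
Lemma gen_subalg_adl S x : (forall y, S y -> subalg_set (gen_subalg S) [lie x, y]) ->
  forall y, subalg_set (gen_subalg S) y -> subalg_set (gen_subalg S) [lie x, y].
Proof.
set N := subalg_set _; have [sN lN] : lie_subalgebra N := subalgP _.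
move=> xS y Ny; suff [] : N y /\ N [lie x, y] by [].
move: y Ny; apply: (gen_subalg_min (B := [set y | N y /\ N [lie x, y]])) => [|y Sy]; last first.
  by split; [apply: sub_gen_subalg|apply: xS].
split; first split.
- by rewrite /= lie0r; case: sN.
- move=> a y z [Ny xy] [Nz xz] /=; rewrite lie_linearr.
  by split; apply: sN.2.
- move=> y z [Ny xy] [Nz xz] /=; rewrite lie_derivation; split; first exact: lN.
  by apply: (subspaceD sN); apply: lN.
Qed.

(** Meant for x = e_i, the generators f_j and C the span of the coroots. As C normalizes the
    generated subalgebra N, the derivation rule puts [x, [y, z]] in N itself once [x, y] and [x, z]
    are in N + C. *)
Lemma gen_subalg_adl_add S C x : subspace C ->
  (forall c y, C c -> S y -> subalg_set (gen_subalg S) [lie c, y]) ->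
  (forall y, S y -> [set a + c | a in gen_subalg S & c in C] [lie x, y]) ->
  forall y, subalg_set (gen_subalg S) y -> [set a + c | a in gen_subalg S & c in C] [lie x, y].
Proof.
set N := subalg_set _; have [sN lN] : lie_subalgebra N := subalgP _.
move=> sC CS xS y Ny; have sNC := subspace_add sN sC.
have CN c z : C c -> N z -> N [lie c, z].
  by move=> Cc; apply: gen_subalg_adl => u; apply: CS.
pose B := [set y | N y /\ [set a + c | a in N & c in C] [lie x, y]].
suff [] : B y by [].
move: y Ny; apply: (gen_subalg_min (B := B)) => [|y Sy]; last first.
  by split; [apply: sub_gen_subalg|apply: xS].
split; first split.
- by rewrite /B /= lie0r; split; [case: sN|case: sNC].
- move=> a y z [Ny xy] [Nz xz]; rewrite /B /= lie_linearr.
  by split; [apply: sN.2|apply: sNC.2].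
- move=> y z [Ny [a Na [c Cc xy]]] [Nz [b Nb [d Cd xz]]].
  split; first exact: lN.
  exists [lie x, [lie y, z]]; last by exists 0; [case: sC|rewrite addr0].
  rewrite lie_derivation -xy -xz lieDl lieDr [[lie y, d]]lieC.
  apply: (subspaceD sN); first by apply: (subspaceD sN); auto.
  by apply: (subspaceB sN); auto.
Qed.

End Normalizers.

(** * The Borcherds Lie algebra *)

Section Quotient.
Variables (F : fieldType) (charF : [pchar F] =i pred0).
Variables (l : nat) (H : vectType F).
Variables (hv : 'I_l -> H) (alpha : 'I_l -> 'Hom(H, F^o)).
Variables (g : lieAlgType F) (p : {linear gtilde hv alpha -> g}).
Hypothesis p_quot : borcherds_quotient p.

Local Notation gt := (gtilde hv alpha).
Local Notation th := (tilde_h hv alpha).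
Local Notation te := (tilde_e hv alpha).
Local Notation tf := (tilde_f hv alpha).

Let p_lie x y : p [lie x, y] = [lie p x, p y].
Proof. by case: p_quot. Qed.

Let p_surj x : exists y, p y = x.
Proof.
have [_ pT _ _] := p_quot; have : [set: g] x by [].
by rewrite -pT => -[y _ <-]; exists y.
Qed.

Lemma quot_h_inj h : p (th h) = 0 -> h = 0.
Proof.
move=> h0; apply: (@tilde_h_inj _ _ _ hv alpha).
have [_ _ [_ kerH] _] := p_quot.
suff : [set 0] (th h) by [].
by rewrite -kerH; split=> //; exists h.
Qed.

Lemma quot_gen (B : set g) : lie_subalgebra B -> (forall h, B (p (th h))) ->
  (forall i, B (p (te i))) -> (forall i, B (p (tf i))) -> B = [set: g].
Proof.
move=> [sB lB] Bh Be Bf; rewrite -subTset => x _; have [y <-] := p_surj x.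
suff : (p @^-1` B) y by [].
rewrite (@tilde_gen _ _ _ hv alpha (p @^-1` B)) //; split.
  by apply: subspace_preimage => // a u v; rewrite linearP.
by move=> u v /= Bu Bv; rewrite p_lie; apply: lB.
Qed.

(** The map is defined on chosen lifts; the condition on the kernel makes the choice immaterial. *)
Lemma quot_descend (phi : {linear gt -> gt}) : lie_morphism phi ->
  (forall x, p x = 0 -> p (phi x) = 0) ->
  exists psi : {linear g -> g}, lie_morphism psi /\ forall x, psi (p x) = p (phi x).
Proof.
move=> lphi phi_ker; pose lift x := sval (cid (p_surj x)).
have liftK x : p (lift x) = x by rewrite /lift; case: cid.
pose psi x := p (phi (lift x)).
have psiE x : psi (p x) = p (phi x).
  apply/subr0_eq; rewrite /psi -!linearB; apply: phi_ker.
  by rewrite linearB liftK subrr.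
have psi_linear : linear psi.
  by move=> a x y; rewrite -[x]liftK -[y]liftK -linearP !psiE !linearP.
pose m := GRing.isLinear.Build F g g _ psi psi_linear.
pose Psi : {linear g -> g} := HB.pack psi m.
exists Psi; split=> // x y /=.
by rewrite -[x]liftK -[y]liftK -p_lie !psiE lphi p_lie.
Qed.

Lemma natf_neq0 n : n.+1%:R != 0 :> F.
Proof. by rewrite ((pcharf0P F).1 charF). Qed.

(** On degree d the map of g~ is multiplication by 2 to the sum of the coordinates of d. It thus
    preserves the kernel of p, which is spanned by homogeneous elements. *)
Lemma quot_scaling : exists T : {linear g -> g},
  [/\ lie_morphism T, forall h, T (p (th h)) = p (th h),
      forall i, T (p (te i)) = 2 *: p (te i) &
      forall i, T (p (tf i)) = 2^-1 *: p (tf i)].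
Proof.
have two_neq0 : 2 != 0 :> F := natf_neq0 1.
have [|h k|h i|h i|i j|T [lT Th Te Tf]] := @tilde_extension _ _ _ hv alpha gt th
  (fun i => 2 *: te i) (fun i => 2^-1 *: tf i).
- exact: tilde_h_linear.
- exact: tilde_hh.
- by rewrite lieZr tilde_he !scalerA mulrC.
- by rewrite lieZr tilde_hf !scalerA mulrC.
- rewrite lieZl lieZr scalerA divff // scale1r; exact: tilde_ef.
have T_hom d x : homogeneous d x -> T x = 2 ^ (\sum_i d 0 i) *: x.
  have sum_delta i : \sum_j (delta_mx 0 i : 'rV[int]_l) 0 j = 1.
    rewrite (bigD1 i) //= mxE !eqxx big1 ?addr0 // => j ji.
    by rewrite mxE (negPf ji) andbF.
  elim=> {d x} [h|i|i|d|d a x y _ IHx _ IHy|c d x y _ IHx _ IHy].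
  - by rewrite Th big1 ?scale1r // => j _; rewrite mxE.
  - by rewrite Te sum_delta.
  - under eq_bigr => j _ do rewrite mxE.
    by rewrite sumrN sum_delta Tf.
  - by rewrite linear0 scaler0.
  - by rewrite linearP IHx IHy scalerDr !scalerA mulrC.
  - rewrite lT IHx IHy lieZl lieZr scalerA -expfzDr // -big_split /=.
    by under [in RHS]eq_bigr => j _ do rewrite mxE.
have T_ker x : p x = 0 -> p (T x) = 0.
  have [_ _ [[_ ker_graded] _] _] := p_quot.
  move=> px0; move: (ker_graded x px0).
  move: x {px0}; apply: (lspan_min (B := [set x | p (T x) = 0])).
    split; first by rewrite /= !linear0.
    by move=> a x y /= Tx Ty; rewrite !linearP Tx Ty scaler0 addr0.
  by move=> x [px0 [d /T_hom Tx]] /=; rewrite Tx linearZ /= px0 scaler0.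
have [Tg [lTg TgE]] := quot_descend lT T_ker.
by exists Tg; split=> // *; rewrite TgE ?Th ?Te ?Tf // linearZ.
Qed.

(** The involution of g~ reverses degrees and preserves h, so the preimage of the kernel of p is
    again a graded ideal meeting h trivially. By maximality it lies in the kernel, and the
    involution descends. *)
Lemma quot_involution : exists sigma : {linear g -> g},
  [/\ lie_morphism sigma, forall x, sigma (sigma x) = x,
      forall h, sigma (p (th h)) = - p (th h),
      forall i, sigma (p (te i)) = - p (tf i) &
      forall i, sigma (p (tf i)) = - p (te i)].
Proof.
have [a h k|h k|h i|h i|i j|sg [lsg sgh sge sgf]] := @tilde_extension _ _ _ hv alpha gt
  (fun h => - th h) (fun i => - tf i) (fun i => - te i).
- by rewrite tilde_h_linear opprD scalerN.
- by rewrite lieNl lieNr tilde_hh !oppr0.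
- by rewrite lieNl lieNr tilde_hf !opprK scaleNr scalerN.
- by rewrite lieNl lieNr tilde_he !opprK scaleNr scalerN opprK.
- by rewrite lieNl lieNr opprK lieC tilde_ef eq_sym; case: eqP => [->|]; rewrite ?oppr0.
have sgK x : sg (sg x) = x.
  suff : [set x | sg (sg x) = x] x by [].
  rewrite (@tilde_gen _ _ _ hv alpha [set x | sg (sg x) = x]) //=; last first.
  - by move=> i; rewrite sgf linearN /= sge opprK.
  - by move=> i; rewrite sge linearN /= sgf opprK.
  - by move=> h; rewrite sgh linearN /= sgh opprK.
  split; first split; rewrite /=.
  - by rewrite !linear0.
  - by move=> a y z sy sz; rewrite !linearP sy sz.
  - by move=> y z sy sz; rewrite !lsg sy sz.
have hom_opp d x : homogeneous d x -> homogeneous d (- x).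
  move=> dx; rewrite -scaleN1r -[_ *: _]addr0.
  by apply: homogeneousD => //; apply: homogeneous0.
have sg_hom d x : homogeneous d x -> homogeneous (- d) (sg x).
  elim=> {d x} [h|i|i|d|d a x y _ IHx _ IHy|c d x y _ IHx _ IHy].
  - by rewrite sgh oppr0; apply/hom_opp/homogeneous_h.
  - by rewrite sge; apply/hom_opp/homogeneous_f.
  - by rewrite sgf opprK; apply/hom_opp/homogeneous_e.
  - by rewrite linear0; apply: homogeneous0.
  - by rewrite linearP; apply: homogeneousD.
  - by rewrite lsg opprD; apply: homogeneous_lie.
have sg_ker x : p x = 0 -> p (sg x) = 0.
  have [_ _ [[[sK idK] ker_graded] kerH] ker_max] := p_quot.
  move=> px0; suff /ker_max : graded_ideal_off_h (sg @^-1` (p @^-1` [set 0])).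
    by apply; rewrite /preimage /= sgK.
  split; [split; [split|]|].
  - by apply: subspace_preimage => // a u v; rewrite linearP.
  - by move=> u v Kv; rewrite /preimage /= lsg; apply: idK.
  - move=> u /ker_graded Ku; rewrite -[u]sgK; move: (sg u) Ku => {}u.
    apply: (lspan_min (B := sg @^-1` (lspan _))) => [|{}u [Ku [d ud]]].
      apply: subspace_preimage; last exact: lspan_subspace.
      by move=> a v w; rewrite linearP.
    apply: sub_lspan; split; first by rewrite /preimage /= sgK.
    by exists (- d); apply: sg_hom.
  - rewrite eqEsubset; split=> [t [+ [h _ tE]]|_ ->].
      rewrite -tE /preimage /= sgh linearN => Ku.
      rewrite -[_ = 0]/([set 0] (th h)) -kerH; split; last by exists h.
      by apply/eqP; rewrite -oppr_eq0; apply/eqP.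
    split; first by rewrite /preimage /= !linear0.
    exists 0 => //; have := tilde_h_linear hv alpha (-1) 0 0.
    by rewrite !scaleN1r !addNr.
have [sgg [lsgg sggE]] := quot_descend lsg sg_ker.
exists sgg; split=> // [x|h|i|i]; last 3 first.
- by rewrite sggE sgh linearN.
- by rewrite sggE sge linearN.
- by rewrite sggE sgf linearN.
by have [y <-] := p_surj x; rewrite !sggE sgK.
Qed.

Lemma pow2_neq1 n : 2 ^+ n.+1 != 1 :> F.
Proof.
rewrite -subr_eq0 -natrX -[1]/(1%:R) -natrB ?expn_gt0 // ((pcharf0P F).1 charF) subn_eq0.
by rewrite -ltnNge -[1%N](expn0 2) ltn_exp2l.
Qed.

(** The scaling has eigenvalue 1 on h, and its eigenvalues on g_+ and g_- are positive and negative
    powers of 2; these three sets are disjoint in characteristic zero. *)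
Lemma quot_direct :
  (forall h x y, subalg_set (g_plus p) x -> subalg_set (g_minus p) y ->
    p (th h) = x + y -> h = 0)
  /\ g_plus p `&` g_minus p = [set 0].
Proof.
have [T [lT Th Te Tf]] := quot_scaling.
pose pos := range (fun n => 2 ^+ n.+1 : F); pose neg := range (fun n => 2 ^- n.+1 : F).
have two_neq0 : 2 != 0 :> F := natf_neq0 1.
have posM a b : pos a -> pos b -> pos (a * b).
  by move=> [m _ <-] [n _ <-]; exists (m + n).+1 => //; rewrite -exprD addSn addnS.
have negM a b : neg a -> neg b -> neg (a * b).
  move=> [m _ <-] [n _ <-]; exists (m + n).+1 => //.
  by rewrite -invfM -exprD addSn addnS.
have plus_pos : g_plus p `<=` eigenspan T pos.
  apply: gen_subalg_min; first exact: eigenspan_lie_subalgebra.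
  by move=> _ [i _ <-]; apply: sub_lspan; exists 2; [exists 0%N|apply: Te].
have minus_neg : g_minus p `<=` eigenspan T neg.
  apply: gen_subalg_min; first exact: eigenspan_lie_subalgebra.
  by move=> _ [i _ <-]; apply: sub_lspan; exists 2^-1; [exists 0%N|apply: Tf].
split.
  move=> h x y /plus_pos px /minus_neg ny hE; apply: quot_h_inj.
  have h1 : eigenspan T [set 1] (p (th h)).
    by apply: sub_lspan; exists 1; rewrite ?scale1r // Th.
  apply: (eigenspan_disjoint (Q := pos `|` neg) _ h1); last rewrite hE.
    move=> c [-> [[n _]|[n _]]] /eqP; last rewrite invr_eq1.
    + by rewrite (negPf (pow2_neq1 n)).
    + by rewrite (negPf (pow2_neq1 n)).
  apply: (subspaceD (lspan_subspace _)).
    by apply: eigenspanS px => c; left.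
  by apply: eigenspanS ny => c; right.
rewrite eqEsubset; split=> [x [/plus_pos px /minus_neg nx]|_ ->]; last first.
  by split; [case: (subalgP (g_plus p)) => [[]]|case: (subalgP (g_minus p)) => [[]]].
(* An equality 2^(m+1) = 2^-(n+1) would give 2^(m+n+2) = 1. *)
apply: (eigenspan_disjoint _ px nx) => c [[m _ <-] [n _]] /eqP.
rewrite eq_sym -subr_eq0 -(mulrI_eq0 _ (mulfI (expf_neq0 n.+1 two_neq0))) mulrBr.
rewrite divff ?expf_neq0 // -exprD subr_eq0 addSn.
by rewrite (negPf (pow2_neq1 _)).
Qed.

Definition coroot_span : set g :=
  range (fun c : 'I_l -> F => p (th (\sum_i c i *: hv i))).

Lemma quot_hB h k : p (th (h - k)) = p (th h) - p (th k).
Proof. by rewrite addrC -scaleN1r tilde_h_linear linearP scaleN1r addrC. Qed.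

Lemma quot_h0 : p (th 0) = 0.
Proof. by rewrite -(subrr 0) quot_hB subrr. Qed.

Lemma coroot_span_subspace : subspace coroot_span.
Proof.
split; first by exists (fun=> 0) => //; rewrite big1 ?quot_h0 // => i _; rewrite scale0r.
move=> a _ _ [c _ <-] [d _ <-]; exists (fun i => a * c i + d i) => //.
rewrite -linearP -tilde_h_linear scaler_sumr -big_split /=; congr (p (th _)).
by apply: eq_bigr => i _; rewrite scalerDl scalerA.
Qed.

Lemma coroot_span_hv i : coroot_span (p (th (hv i))).
Proof.
exists (fun j => (i == j)%:R) => //; congr (p (th _)).
rewrite (bigD1 i) //= eqxx scale1r big1 ?addr0 // => j ji.
by rewrite eq_sym (negPf ji) scale0r.
Qed.

(* [g, g] lies in g_+ + g_- + span(h_i), because the latter is an ideal with  *)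
(* abelian quotient.                                                          *)
Lemma derived_sub : derived g `<=`
  [set x + c | x in [set a + b | a in g_plus p & b in g_minus p] & c in coroot_span].
Proof.
set W := [set _ + _ | _ in _ & _ in _].
have [sP lP] := subalgP (g_plus p); have [sM lM] := subalgP (g_minus p).
have sC := coroot_span_subspace.
have sW : subspace W by apply: subspace_add => //; apply: subspace_add.
have P0 := sP.1; have M0 := sM.1; have C0 := sC.1.
have PW x : subalg_set (g_plus p) x -> W x.
  by move=> Px; exists x; [exists x => //; exists 0; rewrite ?addr0|exists 0; rewrite ?addr0].
have MW x : subalg_set (g_minus p) x -> W x.
  by move=> Mx; exists x; [exists 0 => //; exists x; rewrite ?add0r|exists 0; rewrite ?addr0].
have CW x : coroot_span x -> W x.
  move=> Cx; exists 0; first by exists 0 => //; exists 0; rewrite ?addr0.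
  by exists x; rewrite ?add0r.
have W_ind (B : set g) : subspace B -> g_plus p `<=` B -> g_minus p `<=` B ->
    coroot_span `<=` B -> W `<=` B.
  move=> sB PB MB CB _ [_ [a Pa [b Mb <-]] [c Cc <-]].
  by apply: subspaceD; auto; apply: subspaceD; auto.
have Pe i : subalg_set (g_plus p) (p (te i)) by apply: sub_gen_subalg; exists i.
have Mf i : subalg_set (g_minus p) (p (tf i)) by apply: sub_gen_subalg; exists i.
have he h i : [lie p (th h), p (te i)] = (alpha i h : F) *: p (te i).
  by rewrite -p_lie tilde_he linearZ.
have hf h i : [lie p (th h), p (tf i)] = (- alpha i h : F) *: p (tf i).
  by rewrite -p_lie tilde_hf linearZ.
have ef i j : coroot_span [lie p (te i), p (tf j)].
  rewrite -p_lie tilde_ef; case: eqP => [_|_]; first exact: coroot_span_hv.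
  by rewrite linear0; case: sC.
have hP h x : subalg_set (g_plus p) x -> subalg_set (g_plus p) [lie p (th h), x].
  apply: gen_subalg_adl => _ [i _ <-]; rewrite /= he; exact: (subspaceZ _ sP).
have hM h x : subalg_set (g_minus p) x -> subalg_set (g_minus p) [lie p (th h), x].
  apply: gen_subalg_adl => _ [i _ <-]; rewrite /= hf; exact: (subspaceZ _ sM).
have eM i x : subalg_set (g_minus p) x -> W [lie p (te i), x].
  move=> Mx; have [||b Mb [c Cc <-]] := gen_subalg_adl_add sC _ _ Mx (x := p (te i)).
  - by move=> _ _ [c _ <-] [j _ <-]; rewrite /= hf; apply: (subspaceZ _ sM).
  - by move=> _ [j _ <-]; exists 0 => //; exists [lie p (te i), p (tf j)]; rewrite ?add0r.
  - by apply: subspaceD; auto.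
have fP i x : subalg_set (g_plus p) x -> W [lie p (tf i), x].
  move=> Px; have [||b Pb [c Cc <-]] := gen_subalg_adl_add sC _ _ Px (x := p (tf i)).
  - by move=> _ _ [c _ <-] [j _ <-]; rewrite /= he; apply: (subspaceZ _ sP).
  - move=> _ [j _ <-]; exists 0 => //; exists [lie p (tf i), p (te j)]; rewrite ?add0r //.
    by rewrite lieC -scaleN1r; apply: subspaceZ.
  - by apply: subspaceD; auto.
have hh h k : [lie p (th h), p (th k)] = 0 by rewrite -p_lie tilde_hh linear0.
(* The x with [x, W] inside W form a subalgebra, so it suffices to treat h, e_i and f_i. *)
have W_ideal x y : W y -> W [lie x, y].
  suff WT : [set x | forall y, W y -> W [lie x, y]] = [set: g].
    by move: y; rewrite -[forall y, _]/([set x | forall y, W y -> W [lie x, y]] x) WT.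
  apply: quot_gen => [|h|i|i] /=.
  - split; first split.
    + by move=> z _ /=; rewrite lie0l; case: sW.
    + move=> a u v Wu Wv z Wz /=; rewrite lie_linearl.
      by apply: sW.2; [apply: Wu|apply: Wv].
    + move=> u v Wu Wv z Wz /=.
      have -> : [lie [lie u, v], z] = [lie u, [lie v, z]] - [lie v, [lie u, z]].
        by rewrite lie_derivation addrK.
      by apply: (subspaceB sW); [apply/Wu/Wv|apply/Wv/Wu].
  - apply: W_ind; first exact: subspace_adl.
    + move=> u Pu /=. by apply: PW; apply: hP.
    + by move=> u Mu /=; apply: MW; apply: hM.
    + by move=> _ [c _ <-] /=; rewrite hh; case: sW.
  - apply: W_ind; first exact: subspace_adl.
    + by move=> u Pu /=; apply: PW; apply: lP.
    + by move=> u Mu; apply: eM.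
    + move=> _ [c _ <-] /=; rewrite lieC he -scaleNr.
      apply: PW; exact: (subspaceZ _ sP).
  - apply: W_ind; first exact: subspace_adl.
    + by move=> u Pu; apply: fP.
    + by move=> u Mu /=; apply: MW; apply: lM.
    + move=> _ [c _ <-] /=; rewrite lieC hf -scaleNr.
      apply: MW; exact: (subspaceZ _ sM).
(* g = W + h with h abelian, so any bracket falls into the ideal W. *)
have decomp x : exists2 w, W w & exists h, x = w + p (th h).
  suff DT : [set x | exists2 w, W w & exists h, x = w + p (th h)] = [set: g].
    by rewrite -[ex2 _ _]/([set x | exists2 w, W w & exists h, x = w + p (th h)] x) DT.
  apply: quot_gen => [|h|i|i] /=.
  - split; first split.
    + by exists 0; [case: sW|exists 0; rewrite quot_h0 addr0].
    + move=> a _ _ [u Wu [h ->]] [v Wv [k ->]].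
      exists (a *: u + v); first exact: sW.2.
      exists (a *: h + k); by rewrite tilde_h_linear linearP scalerDr addrACA.
    + move=> _ _ [u Wu [h ->]] [v Wv [k ->]].
      exists [lie u + p (th h), v + p (th k)]; last by exists 0; rewrite quot_h0 addr0.
      rewrite lieDr; apply: (subspaceD sW); first exact: W_ideal.
      rewrite lieDl hh addr0 lieC -scaleN1r; apply: (subspaceZ _ sW); exact: W_ideal.
  - by exists 0; [case: sW|exists h; rewrite add0r].
  - by exists (p (te i)); [apply: PW|exists 0; rewrite quot_h0 addr0].
  - by exists (p (tf i)); [apply: MW|exists 0; rewrite quot_h0 addr0].
apply: lspan_min => // _ [x _ [y _ <-]].
have [u Wu [h ->]] := decomp x; have [v Wv [k ->]] := decomp y.
rewrite lieDr; apply: (subspaceD sW); first exact: W_ideal.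
by rewrite lieDl hh addr0 lieC -scaleN1r; apply: (subspaceZ _ sW); exact: W_ideal.
Qed.

(** By [derived_sub], an element of h in [g, g] differs from a combination of coroots by an element
    of g_+ + g_-; the difference is in h, so it vanishes by [quot_direct]. *)
Lemma cartan_derived : cartan p `&` derived g `<=` coroot_span.
Proof.
move=> _ [[h _ <-] /derived_sub[_ [a Pa [b Mb <-]] [_ [c _ <-] /= hE]]].
exists c => //; congr (p (th _)); apply/esym/subr0_eq.
have [direct _] := quot_direct; apply: (direct _ a b Pa Mb).
by rewrite quot_hB -hE addrK.
Qed.

(** * Relations and generators of U(g) *)

Let X i : env g := env_iota (p (te i)).
Let Y i : env g := env_iota (p (tf i)).
Let eta h : env g := env_iota (p (th h)).

Lemma env_iotaZ a (x : g) : env_iota (a *: x) = a *: env_iota x.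
Proof.
have iota0 : env_iota (0 : g) = 0.
  have := env_iota_linear (-1) (0 : g) 0.
  by rewrite !scaleN1r !addNr.
by rewrite -[_ *: x]addr0 env_iota_linear iota0 addr0.
Qed.

Lemma env_iota_comm (x y : g) :
  env_iota x * env_iota y = env_iota y * env_iota x + env_iota [lie x, y].
Proof. by rewrite env_iota_lie addrC subrK. Qed.

Let etaC h k : eta h * eta k = eta k * eta h.
Proof.
by rewrite /eta env_iota_comm -p_lie tilde_hh linear0 -(scale0r 0) env_iotaZ scale0r addr0.
Qed.

Let eta_X h i : eta h * X i = X i * eta h + (alpha i h : F) *: X i.
Proof. by rewrite /eta /X env_iota_comm -p_lie tilde_he linearZ env_iotaZ. Qed.

Let eta_Y h i : eta h * Y i = Y i * eta h - (alpha i h : F) *: Y i.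
Proof. by rewrite /eta /Y env_iota_comm -p_lie tilde_hf linearZ env_iotaZ scaleNr. Qed.

Let X_Y i j : X i * Y j = Y j * X i + (if i == j then eta (hv i) else 0).
Proof.
rewrite /X /Y env_iota_comm -p_lie tilde_ef; case: eqP => // _.
by rewrite linear0 -(scale0r 0) env_iotaZ scale0r.
Qed.

Lemma quot_env_left_ideal (T : set (env g)) : subspace T -> T 1 ->
  (forall i a, T a -> T (X i * a)) -> (forall i a, T a -> T (Y i * a)) ->
  (forall h a, T a -> T (eta h * a)) -> T = [set: env g].
Proof.
move=> sT T1 TX TY Th.
pose G := range (p \o te) `|` range (p \o tf) `|` range (p \o th).
apply: (@env_left_ideal_full _ _ G) => // [|_ u [[[i _ <-]|[i _ <-]]|[h _ <-]] Tu]; last 3 first.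
- exact: TX.
- exact: TY.
- exact: Th.
apply: quot_gen; first exact: subalgP.
- by move=> h; apply: sub_gen_subalg; right; exists h.
- by move=> i; apply: sub_gen_subalg; left; left; exists i.
- by move=> i; apply: sub_gen_subalg; left; right; exists i.
Qed.

(** * The two factorizations of U(g) *)

Section Envelope.
Variable B : lieSubalg g.
(** Weaker than B being a complement of h' in h, so that B = g_- is also allowed when the coroots
    span h. *)
Hypothesis cartan_dec : forall h, exists2 c, coroot_span c & subalg_set B (p (th h) - c).

Let Z := [set h | subalg_set B (p (th h))].

Let eta_dec h : exists (c : 'I_l -> F) z,
  Z z /\ eta h = \sum_i c i *: eta (hv i) + eta z.
Proof.
have [_ [c _ <-] Bh] := cartan_dec h.
exists c, (h - \sum_i c i *: hv i); split; first by rewrite /Z /= quot_hB.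
have eta_linear : linear eta.
  by move=> a x y; rewrite /eta tilde_h_linear linearP env_iota_linear.
have etaD x y : eta (x + y) = eta x + eta y.
  by have := eta_linear 1 x y; rewrite !scale1r.
rewrite -{1}[h](subrK (\sum_i c i *: hv i)) (etaD (h - _)) [LHS]addrC; congr (_ + _).
elim/big_rec2: _ => [|i y1 y2 _ IH]; last by rewrite eta_linear IH.
by rewrite /eta quot_h0 -(scale0r 0) env_iotaZ scale0r.
Qed.

Let h_word_env s : (forall z, z \in map fst s -> Z z) -> env_sub B (h_word eta s).
Proof.
elim: s => [_|x s IH Zs]; first by rewrite h_word_nil; apply: env_sub1.
rewrite h_word_cons; apply: env_subM.
  apply: (subspaceD (env_sub_subspace B)).
    by apply: env_sub_iota; apply: Zs; rewrite inE eqxx.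
  apply: (subspaceZ _ (env_sub_subspace B)); exact: env_sub1.
by apply: IH => z zs; apply: Zs; rewrite inE zs orbT.
Qed.

(** [straightening] with S the fourfold product: the outer factors absorb e_i on either side, and
    f-words times h-words over B lie in S with outer factors 1. *)
Lemma env_plus_minus_cartan_plus :
  prodspan (prodspan (prodspan (env_sub (g_plus p)) (env_sub (g_minus p)))
    (env_sub B)) (env_sub (g_plus p)) = [set: env g].
Proof.
have PX i : env_sub (g_plus p) (X i).
  by apply: env_sub_iota; apply: sub_gen_subalg; exists i.
apply: (@straightening _ charF _ _ _ hv (fun i h => alpha i h) X Y eta _ _ _ _ _ _ _ _ Z) => //.
- exact: prodspan_subspace.
- move=> i a; do 3!apply: prodspan_mull => {}a.
  exact: env_subM.
- by move=> i a; apply: prodspan_mulr => {}a Pa; apply: env_subM.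
- move=> w s /h_word_env Bs; rewrite -[_ * _]mulr1; apply: mem_prodspan; last exact: env_sub1.
  apply: mem_prodspan => //; rewrite -[f_word _ _]mul1r; apply: mem_prodspan; first exact: env_sub1.
  by apply: env_sub_prod => i _; apply: env_sub_iota; apply: sub_gen_subalg; exists i.
- exact: quot_env_left_ideal.
Qed.

(** The same argument with e and f exchanged. Since [f_i, e_i] = -h_i, the coroots, the roots and
    the coefficients in [eta_dec] all change sign. *)
Lemma env_minus_plus_cartan_minus :
  prodspan (prodspan (prodspan (env_sub (g_minus p)) (env_sub (g_plus p)))
    (env_sub B)) (env_sub (g_minus p)) = [set: env g].
Proof.
have MY i : env_sub (g_minus p) (Y i).
  by apply: env_sub_iota; apply: sub_gen_subalg; exists i.
have etaN h : eta (- h) = - eta h.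
  by rewrite /eta -sub0r quot_hB quot_h0 sub0r -scaleN1r env_iotaZ scaleN1r.
apply: (@straightening _ charF _ _ _ (fun i => - hv i) (fun i h => - alpha i h)
  Y X eta _ _ _ _ _ _ _ _ Z) => //.
- by move=> h i; rewrite eta_Y scaleNr.
- by move=> h i; rewrite eta_X scaleNr opprK.
- move=> i j; rewrite X_Y eq_sym -addrA; case: eqP => [->|_]; last by rewrite !addr0.
  by rewrite etaN subrr addr0.
- exact: prodspan_subspace.
- move=> i a; do 3!apply: prodspan_mull => {}a.
  exact: env_subM.
- by move=> i a; apply: prodspan_mulr => {}a Pa; apply: env_subM.
- move=> w s /h_word_env Bs; rewrite -[_ * _]mulr1; apply: mem_prodspan; last exact: env_sub1.
  apply: mem_prodspan => //; rewrite -[f_word _ _]mul1r; apply: mem_prodspan; first exact: env_sub1.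
  by apply: env_sub_prod => i _; apply: env_sub_iota; apply: sub_gen_subalg; exists i.
- move=> h; have [c [z [Zz ->]]] := eta_dec h.
  exists (fun i => - c i), z; split=> //; congr (_ + _); apply: eq_bigr => i _.
  by rewrite etaN scaleNr scalerN opprK.
- move=> T sT T1 TY TX Th; exact: quot_env_left_ideal.
Qed.

End Envelope.

Lemma complement_cartan_dec (B : lieSubalg g) :
  complement B (cartan p `&` derived g) (cartan p) ->
  forall h, exists2 c, coroot_span c & subalg_set B (p (th h) - c).
Proof.
move=> [_ _ cartanE] h; have : cartan p (p (th h)) by exists h.
rewrite -cartanE => -[x Bx [y /cartan_derived Cy <-]].
by exists y => //; rewrite addrK.
Qed.

End Quotient.

(* K, toR and toF present a subfield of the reals together with an embedding  *)
(* of it in F. Every complement h'' of h' in h is a subalgebra, h being       *)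
(* abelian, so quantifying over subalgebras is no restriction.                *)
Theorem corollary3p2
  (F : fieldType) (charF : [pchar F] =i pred0)
  (R : realType) (K : fieldType)
  (toR : {rmorphism K -> R}) (toF : {rmorphism K -> F})
  (l : nat) (l_gt0 : (0 < l)%N)
  (A : 'M[K]_l) (borcherdsA : borcherds_matrix (map_mx toR A))
  (H : vectType F) (hv : 'I_l -> H) (alpha : 'I_l -> 'Hom(H, F^o))
  (hv_free : free [seq hv i | i : 'I_l])
  (alpha_neq0 : forall i, alpha i != 0)
  (alphaE : forall i j, alpha j (hv i) = toF (A i j))
  (g : lieAlgType F) (p : {linear gtilde hv alpha -> g})
  (p_quot : borcherds_quotient p) :
  [/\ forall h'' : lieSubalg g,
        complement h'' (cartan p `&` derived g) (cartan p) ->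
        prodspan (prodspan (prodspan
            (env_sub (g_plus p)) (env_sub (g_minus p)))
            (env_sub h'')) (env_sub (g_plus p)) = [set: env g] /\
        prodspan (prodspan (prodspan
            (env_sub (g_minus p)) (env_sub (g_plus p)))
            (env_sub h'')) (env_sub (g_minus p)) = [set: env g],
      perfect g -> has_plus_minus_pair g,
      kac_moody_matrix (map_mx toR A) ->
        perfect g -> has_regular_plus_minus_pair g
    & perfect g -> has_regular_plus_minus_pair g].
Proof.
have perfect_pair : perfect g -> has_regular_plus_minus_pair g.
  move=> g_perfect; exists (g_plus p), (g_minus p).
  have [direct disjoint] := quot_direct charF p_quot.
  have hv0_neq0 : hv (Ordinal l_gt0) != 0.
    by apply: (free_not0 hv_free); apply: codom_f.
  have h0_neq0 : p (tilde_h hv alpha (hv (Ordinal l_gt0))) != 0.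
    by apply: contra_neq hv0_neq0; apply: (quot_h_inj p_quot).
  split; first split.
  - move=> PM; have : [set: g] (p (tilde_h hv alpha (hv (Ordinal l_gt0)))) by [].
    rewrite -PM => -[x Px [y My /esym /(direct _ _ _ Px My)]].
    by apply/eqP.
  (* As g is perfect, each element of h is a combination of coroots, so its component in B = g_- can
     be taken to be 0. *)
  - have cartan_dec h : exists2 c, coroot_span p c &
        subalg_set (g_minus p) (p (tilde_h hv alpha h) - c).
      exists (p (tilde_h hv alpha h)); last first.
        by rewrite subrr; have [[]] := subalgP (g_minus p).
      by apply: (cartan_derived charF p_quot); split; [exists h|rewrite g_perfect].
    (* The two middle factors U(g_-)U(g_-) merge into one. *)
    rewrite -subTset -(env_plus_minus_cartan_plus charF p_quot cartan_dec).
    apply: lspan_min => [|_ [x + [y Py <-]]]; first exact: prodspan_subspace.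
    move=> PMMx; apply: mem_prodspan => //; move: x PMMx.
    apply: lspan_min => [|_ [x PMx [z Mz <-]]]; first exact: prodspan_subspace.
    by apply: prodspan_mulr PMx => u Mu; apply: env_subM.
  - split=> //; have [sg [lsg sgK sgh sge sgf]] := quot_involution p_quot.
    have sg_sub (B : lieSubalg g) : lie_subalgebra (sg @^-1` B).
      have [sB lB] := subalgP B; split.
        by apply: subspace_preimage => // a x y; rewrite linearP.
      by move=> x y Bx By; rewrite /preimage /= lsg; apply: lB.
    have sgP : g_plus p `<=` sg @^-1` g_minus p.
      apply: gen_subalg_min => // _ [i _ <-]; rewrite /preimage /= sge -scaleN1r.
      apply: (subspaceZ _ (proj1 (subalgP (g_minus p)))).
      by apply: sub_gen_subalg; exists i.
    have sgM : g_minus p `<=` sg @^-1` g_plus p.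
      apply: gen_subalg_min => // _ [i _ <-]; rewrite /preimage /= sgf -scaleN1r.
      apply: (subspaceZ _ (proj1 (subalgP (g_plus p)))).
      by apply: sub_gen_subalg; exists i.
    exists sg; split=> //.
      (* The involution negates a nonzero coroot, and 2 is invertible, so it is not the identity. *)
      move=> /(_ (p (tilde_h hv alpha (hv (Ordinal l_gt0))))) /eqP.
      rewrite sgh eq_sym -subr_eq0 opprK -mulr2n -scaler_nat scaler_eq0.
      by rewrite (negPf (natf_neq0 charF 1)) (negPf h0_neq0).
    rewrite eqEsubset; split=> [_ [x Px <-]|x Mx]; first exact: sgP.
    by exists (sg x); [apply: sgM|apply: sgK].
split=> // [h'' /(complement_cartan_dec charF p_quot) dec|/perfect_pair].
  split; first exact: env_plus_minus_cartan_plus.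
  exact: env_minus_plus_cartan_minus.
by move=> [P [M [PM _]]]; exists P, M.
Qed.
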